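(* Let $G$ be a finitely presented, residually finite group and let $H$ be a finitely generated group. Then there exist a filtration $(N_i)$ of $G$ and a filtration $(M_i)$ of $H$ such that $\Box_{(N_i)}G$ and $\Box_{(M_i)}H$ are coarsely equivalent if and only if $G$ is commensurable to $H$ via a normal subgroup.
   Context: Filtration: for a residually finite, finitely generated group $G$, a filtration of $G$ is a sequence $(N_i)_{i\in\mathbb{N}}$ of nested ($N_{i+1}\subseteq N_i$), normal, finite index subgroups of $G$ with $\bigcap_i N_i=\{e\}$. Box space: fix a finite generating set $S$ of $G$. The box space $\Box_{(N_i)}G$ is the disjoint union $\bigsqcup_i G/N_i$, where each component $G/N_i$ carries the Cayley graph metric with respect to the image of $S$, and the distance between any two distinct components (i.e. between points of them) is the sum of their diameters. Changing the finite generating set gives a coarsely equivalent space. Coarse equivalence: a map $\varphi:X\to Y$ between metric spaces is a coarse embedding if there are proper functions $\rho_\pm:\mathbb{R}_+\to\mathbb{R}_+$ with $\rho_-(d_X(a,b))\le d_Y(\varphi(a),\varphi(b))\le\rho_+(d_X(a,b))$ for all $a,b\in X$. It is a coarse equivalence if moreover there is $C>0$ such that every $y\in Y$ is at distance at most $C$ from $\varphi(X)$. $X$ and $Y$ are coarsely equivalent if a coarse equivalence $X\to Y$ exists. Commensurable via a normal subgroup: $G$ and $H$ are commensurable via a normal subgroup if there exist a finite index normal subgroup of $G$ and a finite index normal subgroup of $H$ that are isomorphic to each other. *)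

(* Defs.v *)
From HB Require Import structures.
From Stdlib Require Import Relations.
From mathcomp Require Import all_boot all_order all_algebra generic_quotient.
From mathcomp Require Import boolp classical_sets functions cardinality reals.

Set Implicit Arguments.
Unset Strict Implicit.
Unset Printing Implicit Defensive.

Import Order.TTheory GRing.Theory Num.Theory.

Local Open Scope classical_set_scope.
Local Open Scope group_scope.

(* Groups are arbitrary, possibly infinite, inhabitants of [groupType];
   subgroups are classical sets, so no decidability is assumed. *)

Definition is_subgroup (G : groupType) (A : set G) : Prop :=
  group_closed [in A].

Definition is_normal (G : groupType) (A : set G) : Prop :=
  is_subgroup A /\ forall x y : G, A x -> A (x ^ y).

Record normal_subgroup (G : groupType) := NormalSubgroup {
  normal_set :> set G;
  normal_setP : is_normal normal_set }.

Definition generates (G : groupType) (S : set G) : Prop :=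
  smallest (@is_subgroup G) S = [set: G].

Definition finitely_generated (G : groupType) : Prop :=
  exists S : set G, finite_set S /\ generates S.

Section SubgroupTheory.
Variable G : groupType.

Lemma is_subgroupP (A : set G) : is_subgroup A <->
  A 1 /\ forall x y, A x -> A y -> A (x / y).
Proof.
split=> -[A1 AF]; split; first by rewrite -in_setE.
- move=> x y Ax Ay; rewrite -in_setE.
  by apply: AF; rewrite in_setE.
- by rewrite in_setE.
- by move=> x y; rewrite !in_setE; exact: AF.
Qed.

Lemma subgroup1 (A : set G) : is_subgroup A -> A 1.
Proof. by case/is_subgroupP. Qed.

Lemma subgroupV (A : set G) x : is_subgroup A -> A x -> A x^-1.
Proof.
by case/is_subgroupP=> A1 AF Ax; rewrite -[x^-1]mul1g; apply: AF.
Qed.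

Lemma subgroupM (A : set G) x y : is_subgroup A -> A x -> A y -> A (x * y).
Proof.
move=> sA Ax Ay; have [_ AF] := (is_subgroupP A).1 sA.
by rewrite -[y]invgK; apply: AF => //; exact: subgroupV.
Qed.

Lemma smallest_normal (R : set G) : is_normal (smallest (@is_normal G) R).
Proof.
split; first (apply/is_subgroupP; split).
- by move=> A [[sA _] _]; exact: subgroup1.
- move=> x y Rx Ry A AR; have [[/is_subgroupP[_ AF] _] _] := AR.
  by apply: AF; [exact: Rx | exact: Ry].
- by move=> x y Rx A AR; have [[_ AJ] _] := AR; apply: AJ; exact: Rx.
Qed.

Definition normal_closure (R : set G) : normal_subgroup G :=
  NormalSubgroup (smallest_normal R).

End SubgroupTheory.

Section QuotientGroup.
Variables (G : groupType) (N : normal_subgroup G).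

Definition coset_rel : rel G := [rel x y | `[< normal_set N (x^-1 * y) >]].

Let sN : is_subgroup (normal_set N) := (normal_setP N).1.

Lemma coset_rel_refl : reflexive coset_rel.
Proof. by move=> x; apply/asboolP; rewrite mulVg; exact: subgroup1. Qed.

Lemma coset_rel_sym : symmetric coset_rel.
Proof.
move=> x y; apply/asboolP/asboolP => /(subgroupV sN);
  by rewrite invgM invgK.
Qed.

Lemma coset_rel_trans : transitive coset_rel.
Proof.
move=> y x z /asboolP Nxy /asboolP Nyz; apply/asboolP.
by have := subgroupM sN Nxy Nyz; rewrite -mulgA mulVKg.
Qed.

Canonical coset_equiv : equiv_rel G :=
  EquivRel coset_rel coset_rel_refl coset_rel_sym coset_rel_trans.

Definition quotient_group := {eq_quot coset_equiv}%qT.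
HB.instance Definition _ := Choice.on quotient_group.
HB.instance Definition _ := EqQuotient.on quotient_group.

Definition coset_proj (x : G) : quotient_group := \pi_(quotient_group)%qT x.

Lemma coset_projE x y : coset_proj x = coset_proj y <-> normal_set N (x^-1 * y).
Proof.
split=> [/eqP | Nxy]; first by rewrite /coset_proj piE => /asboolP.
by apply/eqP; rewrite /coset_proj piE; apply/asboolP.
Qed.

Lemma coset_reprK q : coset_proj (repr q) = q.
Proof. exact: reprK. Qed.

Definition coset_mul (p q : quotient_group) := coset_proj (repr p * repr q).
Definition coset_inv (p : quotient_group) := coset_proj (repr p)^-1.

Lemma coset_projM x y :
  coset_proj (x * y) = coset_mul (coset_proj x) (coset_proj y).
Proof.
apply/coset_projE; set a := repr _; set b := repr _.
have Na : normal_set N (x^-1 * a) by apply/coset_projE; rewrite coset_reprK.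
have Nb : normal_set N (y^-1 * b) by apply/coset_projE; rewrite coset_reprK.
have -> : (x * y)^-1 * (a * b) = (x^-1 * a) ^ y * (y^-1 * b).
  by rewrite /conjg invgM !mulgA mulgK.
by apply: subgroupM Nb => //; apply: (normal_setP N).2.
Qed.

Lemma coset_projV x : coset_proj x^-1 = coset_inv (coset_proj x).
Proof.
apply/coset_projE; set a := repr _.
have Na : normal_set N (x^-1 * a) by apply/coset_projE; rewrite coset_reprK.
have -> : (x^-1)^-1 * a^-1 = ((x^-1 * a)^-1) ^ x^-1.
  by rewrite /conjg invgM !invgK mulgK.
by apply: (normal_setP N).2; exact: subgroupV.
Qed.

Lemma coset_mulA : associative coset_mul.
Proof.
move=> p q r; rewrite -[p]coset_reprK -[q]coset_reprK -[r]coset_reprK.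
by rewrite -!coset_projM mulgA.
Qed.

Lemma coset_mul1 : left_id (coset_proj 1) coset_mul.
Proof. by move=> p; rewrite -[p]coset_reprK -coset_projM mul1g. Qed.

Lemma coset_mulr1 : right_id (coset_proj 1) coset_mul.
Proof. by move=> p; rewrite -[p]coset_reprK -coset_projM mulg1. Qed.

Lemma coset_mulV : left_inverse (coset_proj 1) coset_inv coset_mul.
Proof.
by move=> p; rewrite -[p]coset_reprK -coset_projV -coset_projM mulVg.
Qed.

Lemma coset_mulrV : right_inverse (coset_proj 1) coset_inv coset_mul.
Proof.
by move=> p; rewrite -[p]coset_reprK -coset_projV -coset_projM mulgV.
Qed.

HB.instance Definition _ := isGroup.Build quotient_group
  coset_mulA coset_mul1 coset_mulr1 coset_mulV coset_mulrV.

HB.instance Definition _ :=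
  isMultiplicative.Build G quotient_group coset_proj coset_projM.

End QuotientGroup.

Section FreeGroup.
Variable X : choiceType.

(* The letter (x, false) stands for x and (x, true) for its inverse. *)
Definition word := seq (X * bool).

Inductive cancel_step : word -> word -> Prop :=
  CancelStep (u v : word) (x : X) (b : bool) :
    cancel_step (u ++ (x, b) :: (x, ~~ b) :: v) (u ++ v).

Definition free_rel : rel word :=
  [rel u v | `[< clos_refl_sym_trans word cancel_step u v >]].

Lemma free_rel_refl : reflexive free_rel.
Proof. by move=> u; apply/asboolP; exact: rst_refl. Qed.

Lemma free_rel_sym : symmetric free_rel.
Proof. by move=> u v; apply/asboolP/asboolP; exact: rst_sym. Qed.

Lemma free_rel_trans : transitive free_rel.
Proof.
move=> v u w /asboolP uv /asboolP vw; apply/asboolP; exact: rst_trans uv vw.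
Qed.

Canonical free_equiv : equiv_rel word :=
  EquivRel free_rel free_rel_refl free_rel_sym free_rel_trans.

Definition free_group := {eq_quot free_equiv}%qT.
HB.instance Definition _ := Choice.on free_group.
HB.instance Definition _ := EqQuotient.on free_group.

Definition free_class (u : word) : free_group := \pi_(free_group)%qT u.

Lemma free_classE u v :
  free_class u = free_class v <-> clos_refl_sym_trans word cancel_step u v.
Proof.
split=> [/eqP | uv]; first by rewrite /free_class piE => /asboolP.
by apply/eqP; rewrite /free_class piE; apply/asboolP.
Qed.

Lemma free_reprK q : free_class (repr q) = q.
Proof. exact: reprK. Qed.

Definition word_inv (u : word) : word := rev [seq (a.1, ~~ a.2) | a <- u].

Definition free_mul (p q : free_group) := free_class (repr p ++ repr q).
Definition free_inv (p : free_group) := free_class (word_inv (repr p)).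

Lemma cancel_rst_cat u u' v v' :
  clos_refl_sym_trans word cancel_step u u' ->
  clos_refl_sym_trans word cancel_step v v' ->
  clos_refl_sym_trans word cancel_step (u ++ v) (u' ++ v').
Proof.
move=> uu' vv'; apply: (@rst_trans _ _ _ (u' ++ v)).
  elim: uu' => {u u'} [_ _ [u w x b] |u|u w _|u w z _ uw _ wz].
  - by rewrite -!catA; apply: rst_step; exact: CancelStep.
  - exact: rst_refl.
  - exact: rst_sym.
  - exact: rst_trans uw wz.
elim: vv' => {v v'} [_ _ [v w x b] |v|v w _|v w z _ vw _ wz].
- by rewrite !catA; apply: rst_step; exact: CancelStep.
- exact: rst_refl.
- exact: rst_sym.
- exact: rst_trans vw wz.
Qed.

Lemma word_invK : involutive word_inv.
Proof.
move=> u; rewrite /word_inv map_rev revK -map_comp -[RHS]map_id.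
by apply: eq_map => -[x b] /=; rewrite negbK.
Qed.

Lemma word_inv_cancel u :
  clos_refl_sym_trans word cancel_step (word_inv u ++ u) [::].
Proof.
elim: u => [|[x b] u IH]; first exact: rst_refl.
apply: rst_trans IH; rewrite {1}/word_inv /= rev_cons cat_rcons.
have := CancelStep (word_inv u) u x (~~ b); rewrite negbK.
exact: rst_step.
Qed.

Lemma free_classM u v :
  free_class (u ++ v) = free_mul (free_class u) (free_class v).
Proof.
apply/free_classE; apply: rst_sym; apply: cancel_rst_cat;
  by apply/free_classE; rewrite free_reprK.
Qed.

Lemma free_mulA : associative free_mul.
Proof.
move=> p q r; rewrite -[p]free_reprK -[q]free_reprK -[r]free_reprK.
by rewrite -!free_classM catA.
Qed.

Lemma free_mul1 : left_id (free_class [::]) free_mul.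
Proof. by move=> p; rewrite -[p]free_reprK -free_classM. Qed.

Lemma free_mulr1 : right_id (free_class [::]) free_mul.
Proof. by move=> p; rewrite -[p]free_reprK -free_classM cats0. Qed.

Lemma free_mulV : left_inverse (free_class [::]) free_inv free_mul.
Proof.
move=> p; rewrite -{2}[p]free_reprK /free_inv -free_classM.
exact/free_classE/word_inv_cancel.
Qed.

Lemma free_mulrV : right_inverse (free_class [::]) free_inv free_mul.
Proof.
move=> p; rewrite -{1}[p]free_reprK /free_inv -free_classM.
apply/free_classE; rewrite -{1}[repr p]word_invK; exact: word_inv_cancel.
Qed.

HB.instance Definition _ := isGroup.Build free_group
  free_mulA free_mul1 free_mulr1 free_mulV free_mulrV.

End FreeGroup.

Definition presented_group (X : choiceType) (R : set (free_group X)) :=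
  quotient_group (normal_closure R).
HB.instance Definition _ (X : choiceType) (R : set (free_group X)) :=
  Group.on (presented_group R).

Definition finitely_presented (G : groupType) : Prop :=
  exists (n : nat) (R : set (free_group 'I_n)), finite_set R /\
    exists f : {multiplicative presented_group R -> G}, bijective f.

Definition finite_index (G : groupType) (N : normal_subgroup G) : Prop :=
  finite_set [set: quotient_group N].

Definition residually_finite (G : groupType) : Prop :=
  forall g : G, g <> 1 ->
    exists N : normal_subgroup G, finite_index N /\ ~ normal_set N g.

Definition is_filtration (G : groupType) (N : nat -> normal_subgroup G) : Prop :=
  [/\ forall i, finite_index (N i),
      forall i, N i.+1 `<=` N i &
      \bigcap_i (N i : set G) = [set 1]].

Definition isomorphic_subgroups (G H : groupType) (A : set G) (B : set H) : Prop :=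
  exists f : G -> H,
    set_bij A B f /\ forall x y, A x -> A y -> f (x * y) = f x * f y.

Definition commensurable_via_normal (G H : groupType) : Prop :=
  exists (K : normal_subgroup G) (L : normal_subgroup H),
    [/\ finite_index K, finite_index L & isomorphic_subgroups K L].

Local Open Scope ring_scope.

Definition cayley_rel (G : groupType) (S : set G) : rel G :=
  [rel x y | `[< S (x^-1 * y)%g \/ S (y^-1 * x)%g >]].

(* Least length of an edge path from x to y. The set of lengths is nonempty
   when the graph is connected, as the Cayley graph of a generating set is;
   otherwise [inf set0] is 0. *)
Definition graph_dist (R : realType) (V : eqType) (e : rel V) (x y : V) : R :=
  inf [set (size p)%:R | p in [set p : seq V | path e x p /\ last x p = y]].

Definition cayley_dist (R : realType) (G : groupType) (S : set G) : G -> G -> R :=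
  graph_dist R (cayley_rel S).

(* A maximum when V is finite. *)
Definition diameter (R : realType) (V : Type) (d : V -> V -> R) : R :=
  sup (range (fun p : V * V => d p.1 p.2)).

Section BoxSpace.
Variables (R : realType) (G : groupType) (S : set G).
Variable N : nat -> normal_subgroup G.

Definition box_space := {i : nat & quotient_group (N i)}.

Definition quotient_dist (i : nat) :
    quotient_group (N i) -> quotient_group (N i) -> R :=
  cayley_dist R (@coset_proj G (N i) @` S).

(* If two distinct components have diameter 0 their distance is 0, so in
   general this is only a pseudometric. *)
Definition box_dist (p q : box_space) : R :=
  if tag p == tag q then quotient_dist (tagged p) (tagged_as p q)
  else diameter (@quotient_dist (tag p)) + diameter (@quotient_dist (tag q)).

End BoxSpace.

(* A proper map of [0, +oo[ to itself, not assumed continuous: preimages of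
   bounded sets are bounded. Values of rho at negative reals are irrelevant. *)
Definition proper_fun (R : realType) (rho : R -> R) : Prop :=
  (forall t, 0 <= t -> 0 <= rho t) /\
  forall M, exists B, forall t, 0 <= t -> rho t <= M -> t <= B.

Definition coarse_embedding (R : realType) (X Y : Type)
    (dX : X -> X -> R) (dY : Y -> Y -> R) (f : X -> Y) : Prop :=
  exists rhom rhop : R -> R, [/\ proper_fun rhom, proper_fun rhop &
    forall a b, rhom (dX a b) <= dY (f a) (f b) <= rhop (dX a b)].

Definition coarse_equivalence (R : realType) (X Y : Type)
    (dX : X -> X -> R) (dY : Y -> Y -> R) (f : X -> Y) : Prop :=
  coarse_embedding dX dY f /\
  exists C : R, 0 < C /\ forall y, exists x, dY y (f x) <= C.

Definition coarsely_equivalent (R : realType) (X Y : Type)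
    (dX : X -> X -> R) (dY : Y -> Y -> R) : Prop :=
  exists f : X -> Y, coarse_equivalence dX dY f.

(* Main.v *)
(* Write words in the generators and call two words r-equivalent when they differ by
   inserting and deleting words of length at most r that represent 1; G is finitely
   presented exactly when, for some r, words with the same value are r-equivalent.

   Given a coarse equivalence of box spaces of infinite groups, all but finitely many
   components G/N_i are each mapped to a single component H/M_j, with uniform constants.
   Lifting such a map edge by edge sends words over S to words over T, and preserves r-equivalence (up to a change of
   r) as soon as M_j contains no short nontrivial element. Lifting there and back is a
   bounded perturbation of the identity. Since i can be chosen after a given pair of words
   over T with the same value, these words are equivalent at a scale independent of them,
   that is, H is finitely presented as well; then for large i the lift sends loops at
   the base point of G/N_i (that is, N_i) isomorphically onto loops in H/M_j (that is, M_j).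

   Conversely, let K and L be isomorphic. The characteristic subgroups C_n of K and D_n of L
   cut out by maps to magmas with n + 1 elements have finite index, correspond to each
   other under the isomorphism and are normal in G and H; G/C_n and H/D_n are then uniformly
   coarsely equivalent through K/C_n = L/D_n. *)
Require Import Defs.
From Stdlib Require Import Relations.
From mathcomp Require Import all_boot all_order all_algebra.
From mathcomp Require Import zify.
From mathcomp Require Import boolp classical_sets functions cardinality reals.

Set Implicit Arguments.
Unset Strict Implicit.
Unset Printing Implicit Defensive.

Import Order.TTheory GRing.Theory Num.Theory.

Local Open Scope classical_set_scope.
Local Open Scope group_scope.

(** * Words and lifts *)

Ltac gnorm :=
  rewrite /conjg ?(invgM, invgK, invg1, mulgA, mul1g, mulg1);
  rewrite ?(mulgK, mulgVK, mulVg, mulgV, mul1g, mulg1, invg1).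

Section Coset.
Variables (G : groupType) (N : normal_subgroup G).
Local Notation pi := (@coset_proj G N).

Lemma coset1 : pi 1 = 1.
Proof. by []. Qed.

Lemma cosetM x y : pi (x * y) = pi x * pi y.
Proof. exact: coset_projM. Qed.

Lemma cosetV x : pi x^-1 = (pi x)^-1.
Proof. exact: coset_projV. Qed.

Lemma coset_proj1P x : pi x = 1 <-> normal_set N x.
Proof.
rewrite -coset1; split=> [/esym/coset_projE | Nx]; first by rewrite invg1 mul1g.
by apply/esym/coset_projE; rewrite invg1 mul1g.
Qed.

End Coset.

Section Words.
Variables (G : groupType) (S : set G).

Definition letter : set G := [set x | S x \/ S x^-1].
Definition letters (w : seq G) : Prop := forall x, x \in w -> letter x.
Definition wprod (w : seq G) : G := \prod_(x <- w) x.
Definition winv (w : seq G) : seq G := rev [seq x^-1 | x <- w].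
Definition ball (n : nat) : set G :=
  [set g | exists w, [/\ letters w, (size w <= n)%N & wprod w = g]].

Lemma letterV x : letter x -> letter x^-1.
Proof. by case=> Sx; [right; rewrite invgK | left]. Qed.

Lemma letters_cons x w : letters (x :: w) <-> letter x /\ letters w.
Proof.
split=> [h | [hx hw] y]; last by rewrite inE => /orP[/eqP -> | /hw].
by split=> [|y yw]; apply: h; rewrite inE ?eqxx ?yw ?orbT.
Qed.

Lemma letters_cat u v : letters u -> letters v -> letters (u ++ v).
Proof. by move=> hu hv x; rewrite mem_cat => /orP[/hu | /hv]. Qed.

Lemma letters_winv w : letters w -> letters (winv w).
Proof. by move=> h x; rewrite mem_rev => /mapP[y /h yw ->]; apply: letterV. Qed.

Lemma size_winv w : size (winv w) = size w.
Proof. by rewrite size_rev size_map. Qed.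

Lemma wprod_nil : wprod [::] = 1.
Proof. by rewrite /wprod big_nil. Qed.

Lemma wprod_cons x w : wprod (x :: w) = x * wprod w.
Proof. by rewrite /wprod big_cons. Qed.

Lemma wprod_seq1 x : wprod [:: x] = x.
Proof. by rewrite wprod_cons wprod_nil mulg1. Qed.

Lemma wprod_cat u v : wprod (u ++ v) = wprod u * wprod v.
Proof. by rewrite /wprod big_cat. Qed.

Lemma winv_cons x w : winv (x :: w) = winv w ++ [:: x^-1].
Proof. by rewrite /winv /= rev_cons cats1. Qed.

Lemma wprod_winv w : wprod (winv w) = (wprod w)^-1.
Proof.
elim: w => [|x w IH]; first by rewrite /winv /= wprod_nil invg1.
by rewrite winv_cons wprod_cat wprod_seq1 IH wprod_cons invgM.
Qed.

Lemma winvK : involutive winv.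
Proof.
move=> w; rewrite /winv map_rev revK -map_comp -[RHS]map_id.
by apply: eq_map => x /=; rewrite invgK.
Qed.

Lemma ball_wprod w : letters w -> ball (size w) (wprod w).
Proof. by exists w. Qed.

Lemma ball1 n : ball n 1.
Proof. by exists [::]; rewrite wprod_nil. Qed.

Lemma ballM m n x y : ball m x -> ball n y -> ball (m + n) (x * y).
Proof.
move=> [u [hu su <-]] [v [hv sv <-]]; exists (u ++ v).
by rewrite wprod_cat size_cat leq_add //; split=> //; apply: letters_cat.
Qed.

Lemma ballV n x : ball n x -> ball n x^-1.
Proof.
move=> [u [hu su <-]]; exists (winv u).
by rewrite wprod_winv size_winv; split=> //; apply: letters_winv.
Qed.

Lemma ball_leq m n : (m <= n)%N -> ball m `<=` ball n.
Proof. by move=> mn x [w [hw sw <-]]; exists w; split=> //; apply: leq_trans mn. Qed.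

Lemma ball0 x : ball 0 x -> x = 1.
Proof. by move=> [w [_ + <-]]; rewrite leqn0 => /nilP ->; rewrite wprod_nil. Qed.

Lemma generates_word : generates S -> forall g, exists2 w, letters w & wprod w = g.
Proof.
move=> genS g; have: [set: G] g by [].
rewrite -genS => gen; apply: (gen [set h | exists2 w, letters w & wprod w = h]); split.
  apply/is_subgroupP; split; first by exists [::]; rewrite ?wprod_nil.
  move=> _ _ [u hu <-] [v hv <-]; exists (u ++ winv v).
    by apply: letters_cat => //; apply: letters_winv.
  by rewrite wprod_cat wprod_winv.
by move=> x Sx; exists [:: x]; rewrite ?wprod_seq1 // => y; rewrite inE => /eqP ->; left.
Qed.

Lemma generates_ball : generates S -> forall g, exists n, ball n g.
Proof. by move=> /generates_word h g; have [w hw <-] := h g; exists (size w), w. Qed.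

Lemma finite_letter : finite_set S -> finite_set letter.
Proof.
move=> fS; apply: (@sub_finite_set _ _ (S `|` (fun x => x^-1) @` S)).
  by move=> x [Sx|Sx]; [left | right; exists x^-1; rewrite ?invgK].
by rewrite finite_setU; split=> //; apply: finite_image.
Qed.

Lemma finite_ball n : finite_set S -> finite_set (ball n).
Proof.
move=> fS; elim: n => [|n IH].
  by apply: (@sub_finite_set _ _ [set 1]) => [x /ball0 ->|]; last exact: finite_set1.
apply: (@sub_finite_set _ _ (ball n `|` [set x * y | x in letter & y in ball n])).
  move=> _ [[|x w] [hw sw <-]]; first by left; rewrite wprod_nil; apply: ball1.
  right; have [hx hw'] := (letters_cons x w).1 hw; exists x => //.
  by exists (wprod w); [exists w | rewrite wprod_cons].
rewrite finite_setU; split=> //; apply: finite_image2 => //.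
exact: finite_letter.
Qed.

(** The r-equivalence of words; deletions come from [ceq_sym]. Only the inserted word has to be over
    [S], so [ceq] is a congruence for concatenation without side conditions. *)
Inductive ceq (r : nat) : seq G -> seq G -> Prop :=
| ceq_refl w : ceq r w w
| ceq_sym u v : ceq r u v -> ceq r v u
| ceq_trans u v w : ceq r u v -> ceq r v w -> ceq r u w
| ceq_insert u w v : letters w -> (size w <= r)%N -> wprod w = 1 ->
    ceq r (u ++ w ++ v) (u ++ v).

Lemma ceq_wprod r u v : ceq r u v -> wprod u = wprod v.
Proof.
elim=> // [|{}u w {}v _ _ w1]; last by rewrite !wprod_cat w1 mul1g.
by move=> ? ? ? _ -> _ ->.
Qed.

Lemma ceq_leq r r' u v : (r <= r')%N -> ceq r u v -> ceq r' u v.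
Proof.
move=> rr; elim=> [w|? ? _|? v' ? _ h _ h'|? w ? hw sw w1].
- exact: ceq_refl.
- exact: ceq_sym.
- exact: ceq_trans h h'.
- by apply: ceq_insert => //; apply: leq_trans rr.
Qed.

Lemma ceq_cat2 r a b u v : ceq r u v -> ceq r (a ++ u ++ b) (a ++ v ++ b).
Proof.
elim=> [w|? ? _|? v' ? _ h _ h'|u' w v' hw sw w1].
- exact: ceq_refl.
- exact: ceq_sym.
- exact: ceq_trans h h'.
- rewrite -!catA !(catA a); exact: ceq_insert.
Qed.

Lemma ceq_cat r u u' v v' : ceq r u u' -> ceq r v v' -> ceq r (u ++ v) (u' ++ v').
Proof.
move=> hu hv; apply: (@ceq_trans _ _ (u' ++ v)).
  exact: (@ceq_cat2 r [::] v _ _ hu).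
by have := @ceq_cat2 r u' [::] _ _ hv; rewrite !cats0.
Qed.

Lemma ceq_cat0l r u v : ceq r u [::] -> ceq r (u ++ v) v.
Proof. by move=> u0; apply: (ceq_cat u0 (ceq_refl r v)). Qed.

Lemma ceq_cat0r r u v : ceq r v [::] -> ceq r (u ++ v) u.
Proof. by move=> v0; have := ceq_cat (ceq_refl r u) v0; rewrite cats0. Qed.

Lemma ceq_relator r w : letters w -> (size w <= r)%N -> wprod w = 1 -> ceq r w [::].
Proof. by move=> hw sw w1; have := @ceq_insert r [::] w [::] hw sw w1; rewrite cats0. Qed.

Lemma ceq_catV r w : (2 <= r)%N -> letters w -> ceq r (w ++ winv w) [::].
Proof.
move=> r2; elim: w => [|x w IH] /=; first by move=> _; apply: ceq_refl.
move=> /letters_cons[hx hw]; rewrite winv_cons catA -cat1s.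
apply: (@ceq_trans _ _ [:: x; x^-1]).
  by rewrite -[X in ceq _ _ X]/([:: x] ++ [::] ++ [:: x^-1]); apply: ceq_cat2; apply: IH.
apply: ceq_relator => //; first by do 2![rewrite letters_cons; split=> //]; apply: letterV.
by rewrite wprod_cons wprod_seq1 mulgV.
Qed.

Lemma ceq_Vcat r w : (2 <= r)%N -> letters w -> ceq r (winv w ++ w) [::].
Proof. by move=> r2 /letters_winv /(ceq_catV r2); rewrite winvK. Qed.

(** Append [winv v ++ v] to [u], which costs only scale 2 because it unfolds one letter pair at a
    time; then [u ++ winv v] is itself a relator of length at most [r]. *)
Lemma ceq_short r u v : (2 <= r)%N -> letters u -> letters v ->
  (size u + size v <= r)%N -> wprod u = wprod v -> ceq r u v.
Proof.
move=> r2 hu hv suv uv; apply: (@ceq_trans _ _ (u ++ winv v ++ v)).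
  by apply: ceq_sym; apply: ceq_cat0r; apply: ceq_Vcat.
rewrite catA; apply: ceq_cat0l.
apply: ceq_relator; rewrite ?size_cat ?size_winv //.
- by apply: letters_cat => //; apply: letters_winv.
- by rewrite wprod_cat wprod_winv uv mulgV.
Qed.

Lemma ceq_cancelr r u v w : (2 <= r)%N -> letters w ->
  ceq r (u ++ w) (v ++ w) -> ceq r u v.
Proof.
move=> r2 hw huv.
have cw x : ceq r ((x ++ w) ++ winv w) x.
  by rewrite -catA; apply: ceq_cat0r; apply: ceq_catV.
apply: (ceq_trans (ceq_sym (cw u))); apply: ceq_trans (cw v).
by apply: ceq_cat => //; apply: ceq_refl.
Qed.

(* Coarse simple connectivity of the Cayley graph: loops contract at scale r. *)
Definition ceq_complete (r : nat) : Prop :=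
  forall u v, letters u -> letters v -> wprod u = wprod v -> ceq r u v.

(** Under this condition a path of length at most [r] that closes up modulo [N] already closes up in
    the group. *)
Definition injectivity_radius (N : set G) (r : nat) : Prop :=
  forall g, ball r g -> N g -> g = 1.

Lemma injectivity_radius_leq N r r' : (r <= r')%N ->
  injectivity_radius N r' -> injectivity_radius N r.
Proof. by move=> rr h g /(ball_leq rr); apply: h. Qed.

End Words.

(** * Lifting words along maps between finite quotients *)

Section Lift.
Variables (G H : groupType) (S : set G) (T : set H).
Variables (N : normal_subgroup G) (M : normal_subgroup H).

Local Notation piG := (@coset_proj G N).
Local Notation piH := (@coset_proj H M).

(** The word [e v s] labels a path from [f v] to the image of the neighbour of [v] along [s]; [lift]
    concatenates such paths. *)
Definition edge_lift (c : nat) (f : quotient_group N -> quotient_group M)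
    (e : quotient_group N -> G -> seq H) : Prop :=
  forall v s, letter S s ->
    [/\ letters T (e v s), (size (e v s) <= c)%N &
        f v * piH (wprod (e v s)) = f (v * piG s)].

Fixpoint lift (e : quotient_group N -> G -> seq H) (v : quotient_group N)
    (w : seq G) : seq H :=
  if w is s :: w' then e v s ++ lift e (v * piG s) w' else [::].

Variables (c : nat) (f : quotient_group N -> quotient_group M).
Variable e : quotient_group N -> G -> seq H.
Hypothesis he : edge_lift c f e.

Lemma lift_cat v u w :
  lift e v (u ++ w) = lift e v u ++ lift e (v * piG (wprod u)) w.
Proof.
elim: u v => [|s u IH] v /=; first by rewrite wprod_nil coset1 mulg1.
by rewrite IH catA wprod_cons cosetM mulgA.
Qed.

Lemma letters_lift v w : letters S w -> letters T (lift e v w).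
Proof.
elim: w v => [//|s w IH] v /letters_cons[hs hw] /=.
by apply: letters_cat; [case: (he v hs) | apply: IH].
Qed.

Lemma size_lift v w : letters S w -> (size (lift e v w) <= c * size w)%N.
Proof.
elim: w v => [//|s w IH] v /letters_cons[hs hw] /=.
by rewrite size_cat mulnS leq_add ?IH //; case: (he v hs).
Qed.

Lemma lift_end v w : letters S w ->
  f v * piH (wprod (lift e v w)) = f (v * piG (wprod w)).
Proof.
elim: w v => [|s w IH] v /=; first by rewrite !wprod_nil !coset1 !mulg1.
move=> /letters_cons[hs hw]; have [_ _ es] := he v hs.
by rewrite wprod_cat wprod_cons !cosetM !mulgA es IH.
Qed.

(** The lift of a relator of length at most [r] closes up in [H/M] and has length at most [c * r],
    so the injectivity radius makes it a relator of [H]. The rest of the lifted word is unchanged,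
    as the relator returns to its starting vertex. *)
Lemma ceq_lift r r' v u w : injectivity_radius T M (c * r) -> (c * r <= r')%N ->
  ceq S r u w -> ceq T r' (lift e v u) (lift e v w).
Proof.
move=> inj rr; elim=> [x|? ? _|? v' ? _ h _ h'|u' x v' hx sx x1].
- exact: ceq_refl.
- exact: ceq_sym.
- exact: ceq_trans h h'.
- rewrite !lift_cat x1 coset1 mulg1; set v1 := v * _.
  have lx := @letters_lift v1 _ hx.
  have sl : (size (lift e v1 x) <= c * r)%N.
    by apply: leq_trans (@size_lift v1 _ hx) _; rewrite leq_mul2l sx orbT.
  apply: ceq_insert => //; first exact: leq_trans rr.
  apply: inj; first by exists (lift e v1 x).
  apply/coset_proj1P; apply: (mulgI (f v1)).
  by rewrite lift_end // x1 coset1 !mulg1.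
Qed.

End Lift.

Arguments letters_lift {G H S T N M c f e} he v w.
Arguments size_lift {G H S T N M c f e} he v w.
Arguments lift_end {G H S T N M c f e} he v w.

Definition displacement (H : groupType) (T : set H) (M : normal_subgroup H)
    (c : nat) (g : quotient_group M -> quotient_group M)
    (k : quotient_group M -> seq H) : Prop :=
  forall y, [/\ letters T (k y), (size (k y) <= c)%N &
                y * coset_proj M (wprod (k y)) = g y].

Section RoundTrip.
Variables (G H : groupType) (S : set G) (T : set H).
Variables (N : normal_subgroup G) (M : normal_subgroup H).
Variables (c r : nat).
Variables (f : quotient_group N -> quotient_group M).
Variables (f' : quotient_group M -> quotient_group N).
Variable e : quotient_group N -> G -> seq H.
Variable e' : quotient_group M -> H -> seq G.
Variable k : quotient_group M -> seq H.
Hypothesis he : edge_lift S T c f e.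
Hypothesis he' : edge_lift T S c f' e'.
Hypothesis hk : displacement T c (f \o f') k.
Hypothesis r_ge : (c * c + 2 * c + 2 <= r)%N.
Hypothesis inj : injectivity_radius T M r.

(** Induction on [w], sliding the displacement path past one letter at a time. Each slide fills a
    square with sides [k y], the double lift of [s], [s] and [k y'], of perimeter at most
    [c * c + 2 * c + 1]; it closes up in [H/M], hence in [H]. *)
Lemma round_trip y w : letters T w ->
  ceq T r (k y ++ lift e (f' y) (lift e' y w)) (w ++ k (y * coset_proj M (wprod w))).
Proof.
elim: w y => [|s w IH] y /=.
  by rewrite wprod_nil coset1 mulg1 cats0 => _; apply: ceq_refl.
move=> /letters_cons[hs hw]; have [le' se' ee'] := he' y hs.
rewrite lift_cat ee' catA wprod_cons cosetM mulgA; set y' := y * coset_proj M s.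
apply: (@ceq_trans _ _ _ _ ((s :: k y') ++ lift e (f' y') (lift e' y' w))).
  apply: ceq_cat; last exact: ceq_refl.
  have [ky sky eky] := hk y; have [ky' sky' eky'] := hk y'.
  have le := letters_lift he (f' y) _ le'.
  have sle : (size (lift e (f' y) (e' y s)) <= c * c)%N.
    by apply: leq_trans (size_lift he _ _ le') _; rewrite leq_mul2l se' orbT.
  have l1 : letters T (k y ++ lift e (f' y) (e' y s)) by apply: letters_cat.
  have l2 : letters T (s :: k y') by apply/letters_cons.
  have s12 : (size (k y ++ lift e (f' y) (e' y s)) + size (s :: k y') <= r)%N.
    rewrite size_cat /=; lia.
  apply: ceq_short => //; first lia.
  apply: (mulgI (wprod (k y ++ lift e (f' y) (e' y s)))^-1); rewrite mulVg.
  apply/esym; apply: inj.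
    by apply: (ball_leq s12); apply: ballM; [apply: ballV|]; apply: ball_wprod.
  apply/coset_projE; apply: (mulgI y).
  rewrite wprod_cat wprod_cons !cosetM !mulgA eky /= (lift_end he) //.
  by rewrite ee' eky'.
exact: (ceq_cat (ceq_refl T r [:: s]) (IH _ hw)).
Qed.

End RoundTrip.

(** Mutually inverse maps up to bounded displacement, together with words witnessing all the bounds
    by the single constant [c]. *)
Definition scale_equivalence (G H : groupType) (S : set G) (T : set H)
    (N : normal_subgroup G) (M : normal_subgroup H) (c : nat) : Prop :=
  exists f f' e e' k k', [/\ @edge_lift G H S T N M c f e, @edge_lift H G T S M N c f' e',
    displacement T c (f \o f') k & displacement S c (f' \o f) k'].

(** * Consequences of lifting: coarse simple connectivity of the target, and isomorphic kernels *)

Section Transfer.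
Variables (G H : groupType) (S : set G) (T : set H).

Lemma ceq_complete_transfer (c r : nat) : ceq_complete S r ->
  (forall n, exists (N : normal_subgroup G) (M : normal_subgroup H),
     [/\ injectivity_radius S N n, injectivity_radius T M n &
         scale_equivalence S T N M c]) ->
  exists r', ceq_complete T r'.
Proof.
move=> cG sc; pose r' := (c * r + (c * c + 2 * c + 2))%N.
exists r' => u v hu hv uv.
(* At the scale [n], which depends on [u] and [v], the two words are trivially equivalent. This is
   only used to see that their lifts to [S] have the same value; the quotients are chosen after [n],
   while [r'] is not. *)
pose n := (size u + size v + 2)%N.
have cuv : ceq T n u v by apply: ceq_short => //; rewrite /n; lia.
have [N [M [iN iM [f [f' [e [e' [k [k' [he he' hk hk']]]]]]]]]] := sc (r' + c * n)%N.
have iM' : injectivity_radius T M r' by apply: injectivity_radius_leq iM; lia.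
have r_ge : (c * c + 2 * c + 2 <= r')%N by rewrite /r'; lia.
have ru := round_trip he he' hk r_ge iM' 1 hu.
have rv := round_trip he he' hk r_ge iM' 1 hv.
have lS : ceq S r (lift e' 1 u) (lift e' 1 v).
  apply: cG; try exact: letters_lift he' _ _ _.
  apply: (@ceq_wprod _ S (c * n)); apply: ceq_lift cuv => //; first exact: he'.
  by apply: injectivity_radius_leq iN; lia.
(* Completeness of [S] has brought the scale down to [r], so lifting back costs only [c * r]. *)
have lT : ceq T r' (lift e (f' 1) (lift e' 1 u)) (lift e (f' 1) (lift e' 1 v)).
  apply: ceq_lift lS; [exact: he | | rewrite /r'; lia].
  by apply: injectivity_radius_leq iM; rewrite /r'; lia.
(* Since [u] and [v] have the same value, both round trips end with the same displacement word,
   which can be cancelled. *)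
apply: (@ceq_cancelr _ T r' u v (k (1 * coset_proj M (wprod u)))); first by rewrite /r'; lia.
  by case: (hk (1 * coset_proj M (wprod u))).
apply: (ceq_trans (ceq_sym ru)); rewrite uv; apply: ceq_trans rv.
by apply: ceq_cat => //; apply: ceq_refl.
Qed.

(** A word for an element of [N] is a loop at 1 in [G/N], and its lift is a loop at [f 1], so the
    value of the lift lies in [M]. Completeness makes this value independent of the spelling,
    concatenation of loops makes the map multiplicative, and the two round trips give
    bijectivity. *)
Lemma isomorphic_of_scale_equivalence (c r : nat)
    (N : normal_subgroup G) (M : normal_subgroup H) :
  generates S -> generates T -> ceq_complete S r -> ceq_complete T r ->
  injectivity_radius S N (c * r + (c * c + 2 * c + 2)) ->
  injectivity_radius T M (c * r + (c * c + 2 * c + 2)) ->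
  scale_equivalence S T N M c -> isomorphic_subgroups N M.
Proof.
move=> gS gT cS cT iN iM [f [f' [e [e' [k [k' [he he' hk hk']]]]]]].
have /choice[wd wdP] : forall g, exists w, letters S w /\ wprod w = g.
  by move=> g; have [w] := generates_word gS g; exists w.
have respects v u w : letters S u -> letters S w -> wprod u = wprod w ->
    wprod (lift e v u) = wprod (lift e v w).
  move=> hu hw uw; apply: (@ceq_wprod _ T (c * r)); apply: (ceq_lift he) => //.
    by apply: injectivity_radius_leq iM; lia.
  exact: cS.
have respects' v u w : letters T u -> letters T w -> wprod u = wprod w ->
    wprod (lift e' v u) = wprod (lift e' v w).
  move=> hu hw uw; apply: (@ceq_wprod _ S (c * r)); apply: (ceq_lift he') => //.
    by apply: injectivity_radius_leq iN; lia.
  exact: cT.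
pose phi g := wprod (lift e 1 (wd g)).
have tripH y w : letters T w -> wprod (k y) * wprod (lift e (f' y) (lift e' y w)) =
    wprod w * wprod (k (y * coset_proj M (wprod w))).
  move=> hw; rewrite -!wprod_cat.
  by apply: ceq_wprod (round_trip he he' hk _ iM y hw); lia.
have tripG y w : letters S w -> wprod (k' y) * wprod (lift e' (f y) (lift e y w)) =
    wprod w * wprod (k' (y * coset_proj N (wprod w))).
  move=> hw; rewrite -!wprod_cat.
  by apply: ceq_wprod (round_trip he' he hk' _ iN y hw); lia.
have piN x : normal_set N x -> coset_proj N x = 1 by move/coset_proj1P.
exists phi; split; first split.
- move=> x Nx; apply/coset_proj1P; have [hw wx] := wdP x.
  by apply: (mulgI (f 1)); rewrite /phi (lift_end he) // wx piN // !mulg1.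
- move=> x y; rewrite !inE => Nx Ny xy.
  have [hx wx] := wdP x; have [hy wy] := wdP y.
  (* Equal images have lifts back to [G] of equal value, and the round trip recovers [x] and [y]
     from these up to the common displacement [k' 1]. *)
  have := tripG 1 _ hx; have := tripG 1 _ hy; rewrite wx wy !piN // => ty tx.
  apply: (mulIg (wprod (k' (1 * 1)))); rewrite -tx -ty; congr (_ * _).
  by apply: respects' => //; exact: letters_lift he _ _ _.
(* Lifting back from [f 1] yields loops at [f' (f 1)] rather than at 1, so [p] is a path moving the
   base point. *)
- move=> t Mt; have [p hp px] := generates_word gS (repr (f' (f 1)) : G).
  have {}px : 1 * coset_proj N (wprod p) = f' (f 1).
    by rewrite mul1g px coset_reprK.
  pose a := wprod (lift e 1 p); pose b := wprod (k (f 1)).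
  have [kl _ kb] := hk (f 1).
  have Mab : normal_set M (a / b).
    have la : f 1 * coset_proj M a = f (f' (f 1)) by rewrite (lift_end he) // px.
    apply/coset_proj1P; rewrite cosetM cosetV; apply/eqP; rewrite divg_eq1; apply/eqP.
    by apply: (mulgI (f 1)); rewrite la kb.
  (* Moving the base point along [p] conjugates by [a], and the round trip conjugates by the
     displacement [b]; conjugating [t] in advance compensates for both. *)
  pose u := t ^ (a / b).
  have Mu : normal_set M u by apply: (normal_setP M).2.
  have piu : coset_proj M u = 1 by apply/coset_proj1P.
  have [w hw wu] := generates_word gT u.
  have lb := letters_lift he' (f 1) _ hw.
  set beta := lift e' (f 1) w in lb.
  have Nb : normal_set N (wprod beta).
    apply/coset_proj1P; apply: (mulgI (f' (f 1))).
    by rewrite (lift_end he') // wu piu !mulg1.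
  have lp := letters_winv hp.
  have lW : letters S (p ++ beta ++ winv p) by do 2?apply: letters_cat.
  exists (wprod (p ++ beta ++ winv p)).
    rewrite !wprod_cat wprod_winv.
    have -> : wprod p * (wprod beta / wprod p) = wprod beta ^ (wprod p)^-1 by gnorm.
    exact: (normal_setP N).2.
  have [hx wx] := wdP (wprod (p ++ beta ++ winv p)).
  rewrite /phi (respects _ _ (p ++ beta ++ winv p)) //.
  rewrite !lift_cat px !wprod_cat (piN _ Nb) mulg1.
  have -> : wprod (lift e (f' (f 1)) (winv p)) = a^-1.
    symmetry; apply: mulg1_eq; rewrite -wprod_cat.
    have := lift_cat e 1 p (winv p); rewrite px => <-.
    rewrite (respects 1 _ [::]) ?wprod_nil //; first exact: letters_cat.
    by rewrite wprod_cat wprod_winv mulgV.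
  have := tripH (f 1) w hw; rewrite wu piu mulg1 -/b => tr.
  have -> : wprod (lift e (f' (f 1)) beta) = b^-1 * (u * b) by rewrite -tr mulKg.
  by rewrite -/a /u; gnorm.
- move=> x y Nx Ny; have [hx wx] := wdP x; have [hy wy] := wdP y.
  have [hxy wxy] := wdP (x * y).
  rewrite /phi (respects _ _ (wd x ++ wd y)) ?wxy ?wprod_cat ?wx ?wy //.
    by rewrite lift_cat wx piN // mulg1 wprod_cat.
  exact: letters_cat.
Qed.

End Transfer.

(** * Finite presentations *)

Lemma finite_set_bound (T : eqType) (A : set T) (P : T -> nat -> Prop) :
  finite_set A -> (forall x m n, (m <= n)%N -> P x m -> P x n) ->
  (forall x, A x -> exists n, P x n) -> exists n, forall x, A x -> P x n.
Proof.
move=> /finite_seqP[s ->] Pmono Pex.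
have {}Pex x : x \in s -> exists n, P x n by move=> xs; apply: Pex.
suff [n nP] : exists n, forall x, x \in s -> P x n by exists n.
elim: s Pex => [_|x s IH Pex]; first by exists 0%N.
have [|n nP] := IH; first by move=> y ys; apply: Pex; rewrite inE ys orbT.
have [|m mP] := Pex x; first by rewrite inE eqxx.
exists (m + n)%N => y; rewrite inE => /orP[/eqP -> | /nP yn].
  by apply: Pmono mP; rewrite leq_addr.
by apply: Pmono yn; rewrite leq_addl.
Qed.

Lemma finite_set_nat_bound (T : eqType) (A : set T) (F : T -> nat) :
  finite_set A -> exists n, forall x, A x -> (F x <= n)%N.
Proof.
move=> fA; apply: finite_set_bound fA _ _ => [x m n mn /leq_trans|x _]; first exact.
by exists (F x).
Qed.

Lemma free_classV (X : choiceType) (w : word X) :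
  (free_class w)^-1 = free_class (word_inv w).
Proof.
apply: (mulIg (free_class w)); rewrite mulVg; apply: esym.
by rewrite -[LHS](free_classM (word_inv w) w); apply/free_classE/word_inv_cancel.
Qed.

Section Presentation.
Variables (G : groupType) (S : set G) (n : nat) (R : set (free_group 'I_n)).
Variable f : {multiplicative presented_group R -> G}.

Let eval (w : word 'I_n) : G :=
  f (coset_proj (normal_closure R) (free_class w)).

Lemma eval_cat u v : eval (u ++ v) = eval u * eval v.
Proof. by rewrite /eval free_classM coset_projM; apply: gmulfM. Qed.

Lemma eval_nil : eval [::] = 1.
Proof. by apply: (mulgI (eval [::])); rewrite -eval_cat mulg1. Qed.

Variable tau : 'I_n * bool -> seq G.
Hypothesis tauP : forall a, letters S (tau a) /\ wprod (tau a) = eval [:: a].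

Let tauw (w : word 'I_n) : seq G := flatten (map tau w).

Lemma tauw_cat u v : tauw (u ++ v) = tauw u ++ tauw v.
Proof. by rewrite /tauw map_cat flatten_cat. Qed.

Lemma letters_tauw w : letters S (tauw w).
Proof. by elim: w => [//|a w IH]; apply: letters_cat; [case: (tauP a) | ]. Qed.

Lemma wprod_tauw w : wprod (tauw w) = eval w.
Proof.
elim: w => [|a w IH]; first by rewrite eval_nil wprod_nil.
by rewrite -cat1s tauw_cat wprod_cat IH eval_cat /tauw /= cats0; have [_ ->] := tauP a.
Qed.

Variable r : nat.
Hypothesis cancel_le : forall a b, (size (tau a) + size (tau b) <= r)%N.
Hypothesis relator_le : forall q, R q -> (size (tauw (repr q)) <= r)%N.

Lemma ceq_tauw_cancel u v :
  clos_refl_sym_trans _ (@cancel_step 'I_n) u v -> ceq S r (tauw u) (tauw v).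
Proof.
elim=> [_ _ [a b x e]|x|x y _|x y z _ h _ h'].
- rewrite (_ : a ++ _ :: _ = a ++ [:: (x, e); (x, ~~ e)] ++ b) // !tauw_cat.
  apply: ceq_insert; first exact: letters_tauw.
    by rewrite /tauw /= cats0 size_cat.
  rewrite wprod_tauw -eval_nil /eval; congr (f (coset_proj _ _)).
  by apply/free_classE/rst_step; apply: (CancelStep [::] [::]).
- exact: ceq_refl.
- exact: ceq_sym.
- exact: ceq_trans h h'.
Qed.

Lemma ceq_tauwV w : ceq S r (tauw (word_inv w) ++ tauw w) [::].
Proof.
rewrite -tauw_cat -[X in ceq _ _ _ X]/(tauw [::]).
exact/ceq_tauw_cancel/word_inv_cancel.
Qed.

Lemma ceq_tauw_insert w u : ceq S r u (tauw w ++ tauw (word_inv w) ++ u).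
Proof.
rewrite catA; apply: ceq_sym; apply: ceq_cat0l.
by have := ceq_tauwV (word_inv w); rewrite word_invK.
Qed.

Let trivial_class : set (free_group 'I_n) :=
  [set q | ceq S r (tauw (repr q)) [::]].

Lemma trivial_classP w : trivial_class (free_class w) <-> ceq S r (tauw w) [::].
Proof.
have cw : ceq S r (tauw (repr (free_class w))) (tauw w).
  by apply/ceq_tauw_cancel/free_classE; rewrite free_reprK.
by split; apply: ceq_trans => //; apply: ceq_sym.
Qed.

Lemma trivial_class_normal : is_normal trivial_class.
Proof.
have trivP q : exists2 w, q = free_class w & (trivial_class q -> ceq S r (tauw w) [::]).
  by exists (repr q); rewrite ?free_reprK.
have freeM u w : (free_class u * free_class w : free_group 'I_n) = free_class (u ++ w).
  by rewrite free_classM.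
split; first (apply/is_subgroupP; split).
- by apply/trivial_classP; apply: ceq_refl.
- move=> p q; have [u -> uP] := trivP p; have [w -> wP] := trivP q.
  move=> /uP up /wP wp; rewrite free_classV freeM; apply/trivial_classP.
  rewrite tauw_cat; apply: (@ceq_trans _ _ _ _ (tauw (word_inv w))).
    exact: ceq_cat0l.
  apply: ceq_trans (ceq_tauwV w); apply: ceq_sym; exact: ceq_cat0r.
- move=> p q; have [u -> uP] := trivP p; have [w -> wP] := trivP q.
  move=> /uP up; rewrite /conjg free_classV (freeM u w) (freeM _ (u ++ w)).
  apply/trivial_classP.
  rewrite !tauw_cat; apply: ceq_trans (ceq_tauwV w).
  by apply: ceq_cat; [exact: ceq_refl | exact: ceq_cat0l].
Qed.

(** The free group elements whose spelling over [S] contracts at scale [r] form a normal subgroup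
    containing [R], hence containing its normal closure; equality of values puts [word_inv u ++ v]
    in that closure. *)
Lemma ceq_tauw : injective f -> forall u v, eval u = eval v -> ceq S r (tauw u) (tauw v).
Proof.
move=> finj u v /finj/coset_projE uv.
have Rt : R `<=` trivial_class.
  move=> q Rq; apply: ceq_relator; [exact: letters_tauw | exact: relator_le |].
  rewrite wprod_tauw -eval_nil /eval free_reprK; congr (f _).
  apply/coset_projE; rewrite mulg1.
  by move=> A [[sA _] RA]; apply: subgroupV => //; apply: RA.
have /trivial_classP : trivial_class (free_class (word_inv u ++ v)).
  by rewrite free_classM -free_classV; apply: uv; split=> //; exact: trivial_class_normal.
rewrite tauw_cat => uv1; apply: ceq_sym.
apply: (ceq_trans (ceq_tauw_insert u (tauw v))).
exact: ceq_cat0r.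
Qed.

End Presentation.

Lemma finitely_presented_ceq_complete (G : groupType) (S : set G) :
  finite_set S -> generates S -> finitely_presented G ->
  exists r, ceq_complete S r.
Proof.
move=> fS gS [n [R [fR [f [f' fK f'K]]]]].
pose eval (w : word 'I_n) : G := f (coset_proj (normal_closure R) (free_class w)).
have /choice[tau tauP] : forall a, exists w, letters S w /\ wprod w = eval [:: a].
  by move=> a; have [w] := generates_word gS (eval [:: a]); exists w.
have /choice[t tP] : forall g, exists w, eval w = g.
  by move=> g; exists (repr (repr (f' g))); rewrite /eval free_reprK coset_reprK f'K.
pose tauw (w : word 'I_n) : seq G := flatten (map tau w).
have [r1 r1P] := finite_set_nat_bound (fun s => size (tauw (t s))) (finite_letter fS).
have [r2 r2P] := finite_set_nat_bound (fun q => size (tauw (repr q))) fR.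
have [r3 r3P] := finite_set_nat_bound (fun a => size (tau a))
  (finite_finset (X := [set: 'I_n * bool])).
(* [r1] serves to replace a letter [s] by the spelling of [t s], [r2] to contract the relators, and
   [r3 + r3] to cancel a generator against its inverse. The 2 covers the single letter [s] and free
   cancellations over [S]. *)
pose r := (r1 + r2 + (r3 + r3) + 2)%N; exists r.
have htau a b : (size (tau a) + size (tau b) <= r)%N.
  by have := r3P a I; have := r3P b I; rewrite /r; lia.
have hR q : R q -> (size (tauw (repr q)) <= r)%N.
  by move=> /r2P h; apply: leq_trans h _; rewrite /r; lia.
pose T (u : seq G) : word 'I_n := flatten (map t u).
have evalT u : eval (T u) = wprod u.
  elim: u => [|x u IH]; first by rewrite wprod_nil; apply: eval_nil.
  by rewrite wprod_cons -IH -[in RHS](tP x); apply: eval_cat.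
have ceqT u : letters S u -> ceq S r u (tauw (T u)).
  elim: u => [_|x u IH /letters_cons[hx hu]]; first exact: ceq_refl.
  rewrite /T /= -/(T u) /tauw map_cat flatten_cat -/(tauw _) -/(tauw _).
  rewrite -[x :: u]cat1s; apply: ceq_cat; last exact: IH.
  apply: ceq_short; [by rewrite /r; lia | | | |].
  - by apply/letters_cons.
  - exact: (letters_tauw tauP).
  - by have := r1P x hx; rewrite /r /=; lia.
  - by rewrite wprod_seq1 (wprod_tauw tauP) -[LHS]tP.
move=> u v hu hv uv.
apply: (ceq_trans (ceqT u hu)); apply: ceq_trans (ceq_sym (ceqT v hv)).
apply: (ceq_tauw tauP htau hR (can_inj fK)).
by have := evalT u; rewrite uv -evalT.
Qed.

(** * Integer-valued box distances *)

(** The existential stands outside the hypothesis so that [least] is total; for an empty predicate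
    its value is unspecified. *)
Lemma exists_least (P : nat -> Prop) : exists n, (exists m, P m) ->
  P n /\ forall m, P m -> (n <= m)%N.
Proof.
have [[m Pm]|nP] := EM (exists m, P m); last by exists 0%N.
have exP : exists m, `[< P m >] by exists m; apply/asboolP.
exists (ex_minn exP) => _; case: ex_minnP => n /asboolP Pn min_n.
by split=> // k /asboolP; apply: min_n.
Qed.

Definition least (P : nat -> Prop) : nat := sval (cid (exists_least P)).

Lemma leastP (P : nat -> Prop) : (exists m, P m) ->
  P (least P) /\ forall m, P m -> (least P <= m)%N.
Proof. exact: (svalP (cid (exists_least P))). Qed.

Section Length.
Variables (G : groupType) (S : set G).

Definition len (g : G) : nat := least (fun n => ball S n g).

Definition spanning : Prop := forall g, exists n, ball S n g.

Hypothesis hS : spanning.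

Lemma len_ball g n : (len g <= n)%N <-> ball S n g.
Proof.
have [bl ml] := leastP (hS g); split; last exact: ml.
by move=> h; apply: ball_leq bl.
Qed.

Lemma ball_len g : ball S (len g) g.
Proof. exact/len_ball. Qed.

Lemma len1 : len 1 = 0%N.
Proof. by apply/eqP; rewrite -leqn0; apply/len_ball/ball1. Qed.

Lemma lenV g : len g^-1 = len g.
Proof.
have le h : (len h^-1 <= len h)%N by apply/len_ball/ballV/ball_len.
by apply/eqP; rewrite eqn_leq le -{1}[g]invgK le.
Qed.

Lemma lenM g h : (len (g * h) <= len g + len h)%N.
Proof. by apply/len_ball/ballM; apply: ball_len. Qed.

Lemma cayley_path_word x y n :
  (exists p, [/\ path (cayley_rel S) x p, last x p = y & size p = n]) <->
  (exists w, [/\ letters S w, x * wprod w = y & size w = n]).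
Proof.
split=> [[p [pp <- <-]] | [w [hw <- <-]]].
  elim: p x pp => [|z p IH] x /=; first by exists [::]; rewrite wprod_nil mulg1.
  move=> /andP[/asboolP xz /IH[w [hw we sw]]]; exists (x^-1 * z :: w); split.
  - apply/letters_cons; split=> //; case: xz => xz; first by left.
    by right; rewrite invgM invgK.
  - by rewrite wprod_cons !mulgA mulgV mul1g.
  - by rewrite /= sw.
elim: w x hw => [|s w IH] x; first by exists [::]; rewrite wprod_nil mulg1.
move=> /letters_cons[hs /(IH (x * s))[p [pp pl sp]]]; exists (x * s :: p) => /=.
rewrite pl wprod_cons mulgA sp; split=> //; rewrite pp andbT; apply/asboolP.
by rewrite mulKg invgM mulgVK; exact: hs.
Qed.

(** Edge paths from [x] to [y] are words for [x^-1 * y], and the infimum of their lengths is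
    attained by a shortest word. *)
Lemma cayley_distE (R : realType) x y :
  cayley_dist R S x y = (len (x^-1 * y))%:R%R.
Proof.
have [w [hw sw we]] := ball_len (x^-1 * y).
rewrite /cayley_dist /graph_dist; set A := (X in inf X).
have lbA : lbound A (len (x^-1 * y))%:R%R.
  move=> _ /= [p [pp pl] <-]; rewrite ler_nat; apply/len_ball.
  have [|v [hv ve <-]] := (cayley_path_word x y (size p)).1; first by exists p.
  by exists v; rewrite -ve mulKg.
have [|p [pp pl sp]] := (cayley_path_word x y (size w)).2.
  by exists w; rewrite we mulVKg.
have Ap : A (size w)%:R%R by exists p; rewrite ?sp.
apply/eqP; rewrite eq_le; apply/andP; split.
  apply: (@le_trans _ _ (size w)%:R%R); last by rewrite ler_nat.
  by apply: ge_inf => //; exists (len (x^-1 * y))%:R%R.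
by apply: lb_le_inf lbA; exists (size w)%:R%R.
Qed.

Definition ndiam : nat := least (fun n => forall g, ball S n g).

Hypothesis finG : finite_set [set: G].

Lemma ndiam_ball n : (ndiam <= n)%N <-> forall g, ball S n g.
Proof.
have [|bl ml] := @leastP (fun n => forall g, ball S n g).
  have [k kP] := finite_set_nat_bound len finG.
  by exists k => g; apply/len_ball/kP.
split; last exact: ml.
by move=> h g; apply: ball_leq (bl g).
Qed.

Lemma len_ndiam g : (len g <= ndiam)%N.
Proof. by apply/len_ball; move: g; apply/ndiam_ball. Qed.

Lemma ndiam_attained : exists g, len g = ndiam.
Proof.
case: (posnP ndiam) => [-> | d0]; first by exists 1; apply: len1.
have [/ndiam_ball | /existsNP[g gP]] := EM (forall g, ball S ndiam.-1 g).
  by rewrite leqNgt prednK ?leqnn.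
exists g; apply/eqP; rewrite eqn_leq len_ndiam /=.
rewrite -[X in (X <= _)%N](prednK d0) ltnNge; apply/negP => /len_ball.
exact: gP.
Qed.

Lemma diameterE (R : realType) : diameter (cayley_dist R S) = ndiam%:R%R.
Proof.
have ubA : ubound (range (fun p : G * G => cayley_dist R S p.1 p.2)) ndiam%:R%R.
  by move=> _ [p _ <-]; rewrite cayley_distE ler_nat len_ndiam.
have [g gd] := ndiam_attained.
have Ad : range (fun p : G * G => cayley_dist R S p.1 p.2) ndiam%:R%R.
  by exists (1, g) => //=; rewrite cayley_distE invg1 mul1g gd.
apply/eqP; rewrite eq_le; apply/andP; split.
  by apply: ge_sup ubA; exists ndiam%:R%R.
by apply: ub_le_sup Ad; exists ndiam%:R%R.
Qed.

End Length.

Section QuotientBall.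
Variables (G : groupType) (S : set G) (N : normal_subgroup G).
Local Notation pi := (@coset_proj G N).

Lemma letter_image (q : quotient_group N) :
  letter (pi @` S) q <-> exists2 g, letter S g & pi g = q.
Proof.
split=> [[[g Sg gq] | [g Sg gq]] | [g [Sg|Sg] <-]].
- by exists g; first left.
- by exists g^-1; [right; rewrite invgK | rewrite cosetV gq invgK].
- by left; exists g.
- by right; exists g^-1; rewrite ?cosetV.
Qed.

Lemma ball_image n (q : quotient_group N) :
  ball (pi @` S) n q <-> exists2 g, ball S n g & pi g = q.
Proof.
split=> [[w [hw sw <-]] | [_ [w [hw sw <-]] <-]].
  suff [v [hv sv vw]] : exists v, [/\ letters S v, size v = size w & pi (wprod v) = wprod w].
    by exists (wprod v) => //; exists v; rewrite sv.
  elim: w hw {sw} => [_|x w IH /letters_cons[/letter_image[g Sg gx] /IH[v [hv sv vw]]]].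
    by exists [::]; rewrite !wprod_nil.
  exists (g :: v); rewrite /= sv !wprod_cons cosetM gx vw; split=> //.
  exact/letters_cons.
exists (map pi w); split; rewrite ?size_map //.
  by move=> _ /mapP[s sw' ->]; apply/letter_image; exists s => //; apply: hw.
elim: w {hw sw} => [|s w IH] /=; first by rewrite !wprod_nil.
by rewrite !wprod_cons cosetM IH.
Qed.

Lemma spanning_image : spanning S -> spanning (pi @` S).
Proof.
move=> hS q; have [n bn] := hS (repr q).
by exists n; apply/ball_image; exists (repr q); rewrite ?coset_reprK.
Qed.

End QuotientBall.

Definition qlen (G : groupType) (S : set G) (K : normal_subgroup G)
  (q : quotient_group K) : nat := len (@coset_proj G K @` S) q.
Definition qdiam (G : groupType) (S : set G) (K : normal_subgroup G) : nat :=
  ndiam (@coset_proj G K @` S).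

Section BoxDistance.
Variables (G : groupType) (S : set G) (N : nat -> normal_subgroup G).

Definition box_ndist (p q : box_space N) : nat :=
  if tag p == tag q then qlen S ((tagged p)^-1 * tagged_as p q)
  else (qdiam S (N (tag p)) + qdiam S (N (tag q)))%N.

Lemma box_distE (R : realType) : spanning S -> (forall i, finite_index (N i)) ->
  @box_dist R G S N = fun p q => (box_ndist p q)%:R%R.
Proof.
move=> hS fN; apply/funext => p; apply/funext => q.
have hQ i := @spanning_image G S (N i) hS.
rewrite /box_dist /box_ndist /quotient_dist; case: eqP => _.
  by rewrite cayley_distE.
by rewrite (diameterE (hQ _) (fN _)) (diameterE (hQ _) (fN _)) -natrD.
Qed.

Definition box_point i (a : quotient_group (N i)) : box_space N :=
  Tagged (fun i => quotient_group (N i)) a.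

Lemma box_ndist_same i (a b : quotient_group (N i)) :
  box_ndist (box_point a) (box_point b) = qlen S (a^-1 * b).
Proof. by rewrite /box_ndist /= eqxx (tagged_asE (T_ := fun i => quotient_group (N i))). Qed.

Lemma box_ndist_diff i j (a : quotient_group (N i)) (b : quotient_group (N j)) :
  i <> j -> box_ndist (box_point a) (box_point b) = (qdiam S (N i) + qdiam S (N j))%N.
Proof. by rewrite /box_ndist /= => /eqP/negbTE ->. Qed.

End BoxDistance.

Definition nat_coarse_equivalence (X Y : Type) (dX : X -> X -> nat) (dY : Y -> Y -> nat)
    (f : X -> Y) : Prop :=
  [/\ forall n, exists m, forall a b, (dX a b <= n)%N -> (dY (f a) (f b) <= m)%N,
      forall n, exists m, forall a b, (dY (f a) (f b) <= n)%N -> (dX a b <= m)%N &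
      exists c, forall y, exists x, (dY y (f x) <= c)%N].

(** For integer distances, proper control functions carry the same information as bounds on the
    image, respectively the preimage, of each distance range. *)
Lemma coarse_equivalence_nat (R : realType) (X Y : Type) (dX : X -> X -> nat)
    (dY : Y -> Y -> nat) (f : X -> Y) :
  coarse_equivalence (R := R) (fun a b => (dX a b)%:R%R) (fun a b => (dY a b)%:R%R) f <->
  nat_coarse_equivalence dX dY f.
Proof.
split=> [[[rm [rp [[_ prm] _ ctl]]] [c [_ cP]]] | [up lo [c cP]]].
  split.
  (* [rp] need not be monotone, so its values at all distances up to [n] are taken into account and
     rounded up. *)
  - move=> n; exists (\max_(k < n.+1) (Num.truncn (rp k%:R%R)).+1) => a b dn.
    have k : (dX a b < n.+1)%N by [].
    apply: leq_trans (leq_bigmax (Ordinal k)) => /=.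
    have /andP[_ h] := ctl a b.
    by rewrite -(@ler_nat R); apply: le_trans h _; apply/ltW/truncnS_gt.
  - move=> n; have [B BP] := prm n%:R%R.
    exists (Num.truncn B).+1 => a b dn.
    have /andP[h _] := ctl a b.
    rewrite -(@ler_nat R); apply: le_trans (BP _ _ _) _ => //.
      by apply: le_trans h _; rewrite ler_nat.
    exact/ltW/truncnS_gt.
  - exists (Num.truncn c).+1 => y; have [x xP] := cP y; exists x.
    by rewrite -(@ler_nat R); apply: le_trans xP _; apply/ltW/truncnS_gt.
split; last first.
  exists c.+1%:R%R; split=> // y; have [x xP] := cP y; exists x.
  by rewrite ler_nat; apply: leqW.
have /choice[F FP] := up; have /choice[E EP] := lo.
(* A generalised inverse of the bound [E]. Taking the maximum with [m] guarantees that some [m]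
   reaches [k], even when [E] is bounded. *)
pose h k := least (fun m => (k <= maxn (E m) m)%N).
have hP k : (k <= maxn (E (h k)) (h k))%N /\
    forall m, (k <= maxn (E m) m)%N -> (h k <= m)%N.
  by apply: (@leastP (fun m => (k <= maxn (E m) m)%N)); exists k; rewrite leq_max leqnn orbT.
(* The lower function is proper because [h k] at most [m] bounds [k] by finitely many values of [E];
   the summand [|t|] makes the upper one proper. *)
exists (fun t => (h (Num.truncn t))%:R%R), (fun t => ((F (Num.truncn t))%:R + `|t|)%R).
split; first split=> // [M].
- exists (\max_(m < (Num.truncn M).+1) maxn (E m) m).+1%:R%R => t t0 htM.
  have htm : (h (Num.truncn t) < (Num.truncn M).+1)%N.
    rewrite ltnS truncn_ge_nat //; apply: le_trans htM; exact: ler0n.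
  apply: le_trans (ltW (truncnS_gt t)) _; rewrite ler_nat ltnS.
  by apply: leq_trans (hP _).1 _; apply: (leq_bigmax (Ordinal htm)).
- split=> [t t0 | M]; first by rewrite addr_ge0 // normr_ge0.
  exists M => t t0; apply: le_trans; apply: le_trans (ler_norm t) _.
  by rewrite lerDr.
- move=> a b; rewrite !natrK ler_nat; apply/andP; split.
    by apply: (hP _).2; rewrite leq_max (EP _ a b (leqnn _)).
  by apply: ler_wpDr; [exact: normr_ge0 | rewrite ler_nat; apply: FP].
Qed.

(** * From box spaces to commensurability *)

Section QuotientLength.
Variables (G : groupType) (S : set G) (K : normal_subgroup G).
Hypothesis hS : spanning S.

Lemma qlen_word n (q : quotient_group K) : (qlen S q <= n)%N ->
  exists w, [/\ letters S w, (size w <= n)%N & coset_proj K (wprod w) = q].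
Proof. by move=> /(len_ball (spanning_image hS))/ball_image[g [w [hw sw <-]] <-]; exists w. Qed.

Lemma qlen_coset g : (qlen S (coset_proj K g) <= len S g)%N.
Proof.
apply/(len_ball (spanning_image hS))/ball_image; exists g => //.
exact: ball_len.
Qed.

Lemma qlen_letter s : letter S s -> (qlen S (coset_proj K s) <= 1)%N.
Proof.
move=> hs; apply: leq_trans (qlen_coset s) _; apply/len_ball => //.
by exists [:: s]; rewrite wprod_seq1; split=> //; apply/letters_cons.
Qed.

End QuotientLength.

Section BoxMetric.
Variables (G : groupType) (S : set G) (N : nat -> normal_subgroup G).
Hypothesis hS : spanning S.
Hypothesis fN : forall i, finite_index (N i).

Let hQ i : spanning (@coset_proj G (N i) @` S) := @spanning_image G S (N i) hS.

Lemma box_ndist_sym (p q : box_space N) : box_ndist S p q = box_ndist S q p.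
Proof.
move: p q => [i a] [j b]; rewrite -/(box_point a) -/(box_point b).
have [ij | ij] := EM (i = j); last first.
  by rewrite box_ndist_diff // box_ndist_diff 1?addnC // => /esym.
subst j; rewrite !box_ndist_same /qlen -(lenV (@hQ i)).
by rewrite invgM invgK.
Qed.

Lemma box_ndist_triangle (p q r : box_space N) :
  (box_ndist S p r <= box_ndist S p q + box_ndist S q r)%N.
Proof.
move: p q r => [i a] [j b] [k c].
rewrite -/(box_point a) -/(box_point b) -/(box_point c).
have [ij | ij] := EM (i = j); have [jk | jk] := EM (j = k).
- subst j k; rewrite !box_ndist_same.
  have -> : a^-1 * c = (a^-1 * b) * (b^-1 * c) by rewrite mulgA mulgK.
  exact: (lenM (@hQ i)).
- by subst j; rewrite box_ndist_same !box_ndist_diff // leq_addl.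
- by subst k; rewrite box_ndist_same !box_ndist_diff // leq_addr.
- rewrite (box_ndist_diff _ _ _ ij) (box_ndist_diff _ _ _ jk).
  have [ik | ik] := EM (i = k); last by rewrite box_ndist_diff //; lia.
  subst k; rewrite box_ndist_same.
  have : (qlen S (a^-1 * c)%g <= qdiam S (N i))%N by exact: (len_ndiam (@hQ i) (fN i)).
  by lia.
Qed.

Lemma qdiam_attained i : exists q : quotient_group (N i), qlen S q = qdiam S (N i).
Proof. exact: (ndiam_attained (@hQ i) (fN i)). Qed.

Lemma qdiam_ge i (q : quotient_group (N i)) : (qlen S q <= qdiam S (N i))%N.
Proof. exact: (len_ndiam (@hQ i) (fN i)). Qed.

Lemma box_ndist_lt_qdiam i (a : quotient_group (N i)) (q : box_space N) :
  (box_ndist S (box_point a) q < qdiam S (N i))%N -> exists b, q = box_point (i := i) b.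
Proof.
move: q => [j b]; rewrite -/(box_point b); have [ij | ij] := EM (i = j).
  by subst j; exists b.
by rewrite box_ndist_diff //; lia.
Qed.

Lemma finite_box_bounded : finite_set [set: G] ->
  exists d, forall p q : box_space N, (box_ndist S p q <= d)%N.
Proof.
move=> finG; have [d dP] := finite_set_nat_bound (len S) finG.
have qd i (q : quotient_group (N i)) : (qlen S q <= d)%N.
  by rewrite -[q]coset_reprK; apply: leq_trans (qlen_coset _ hS _) (dP _ I).
exists (d + d)%N => p q; rewrite /box_ndist; case: eqP => _.
  by apply: leq_trans (qd _ _) (leq_addr _ _).
have [a <-] := qdiam_attained (tag p); have [b <-] := qdiam_attained (tag q).
exact: leq_add.
Qed.

Hypothesis nested : forall i, N i.+1 `<=` N i.

Lemma nested_leq i j : (i <= j)%N -> N j `<=` N i.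
Proof.
elim: j => [|j IH]; first by rewrite leqn0 => /eqP ->.
by rewrite leq_eqVlt => /orP[/eqP -> // | /IH ji] x /nested; apply: ji.
Qed.

Lemma qdiam_leq i j : (i <= j)%N -> (qdiam S (N i) <= qdiam S (N j))%N.
Proof.
move=> ij; apply/(ndiam_ball (@hQ i) (fN i)) => q; apply/ball_image.
have [/(_ (leqnn _)) + _] := ndiam_ball (@hQ j) (fN j) (qdiam S (N j)).
move=> /(_ (coset_proj (N j) (repr q)))/ball_image[g bg gq].
exists g => //; rewrite -[q]coset_reprK; apply/coset_projE.
by apply: (nested_leq ij); apply/coset_projE.
Qed.

Lemma box_ndist_qdiam i (p q : box_space N) : (tag p <= i)%N -> (tag q <= i)%N ->
  (box_ndist S p q <= 2 * qdiam S (N i))%N.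
Proof.
move: p q => [j a] [k b] /= /qdiam_leq ji /qdiam_leq ki.
rewrite -/(box_point a) -/(box_point b); have [jk | jk] := EM (j = k).
  by subst k; rewrite box_ndist_same; have := qdiam_ge (a^-1 * b); lia.
by rewrite box_ndist_diff //; lia.
Qed.

Hypothesis capN : \bigcap_i (N i : set G) = [set 1].
Hypothesis fS : finite_set S.

(** Each nontrivial element of the finite ball leaves the filtration at some index, and by
    nestedness stays out afterwards. *)
Lemma filtration_injectivity_radius r :
  exists i0, forall i, (i0 <= i)%N -> injectivity_radius S (N i) r.
Proof.
have [|x m n mn P /(nested_leq mn)|x _|i0 h] :=
    @finite_set_bound _ (ball S r) (fun g i => normal_set (N i) g -> g = 1).
- exact: finite_ball.
- exact: P.
- have [-> | x1] := EM (x = 1); first by exists 0%N.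
  have [i Nix] : exists i, ~ normal_set (N i) x.
    apply/existsNP => Nx; apply: x1.
    suff : [set 1] x by [].
    by rewrite -capN => i _; apply: Nx.
  by exists i.
- by exists i0 => i ii g gr Ng; apply: h gr _; apply: (nested_leq ii).
Qed.

(** In fact [G] is the ball of radius [d]: an element agrees with an element of that ball in a deep
    enough quotient, and there the injectivity radius forces equality. *)
Lemma bounded_qdiam_finite d : (forall i, qdiam S (N i) <= d)%N -> finite_set [set: G].
Proof.
move=> hd; apply: (@sub_finite_set _ _ (ball S d)); last exact: finite_ball.
move=> g _; have [n gn] := hS g.
have [i /(_ _ (leqnn i)) inj] := filtration_injectivity_radius (d + n).
have /(len_ball (@hQ i))/ball_image[h bh hg] : (qlen S (coset_proj (N i) g) <= d)%N.
  by apply: leq_trans (hd i); apply: qdiam_ge.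
suff <- : h = g by [].
apply: (mulgI h^-1); rewrite mulVg; apply: esym; apply: inj.
  by apply: ballM => //; apply: ballV.
exact/coset_projE.
Qed.

Lemma unbounded_qdiam : ~ finite_set [set: G] -> forall d, exists i0,
  forall i, (i0 <= i)%N -> (d < qdiam S (N i))%N.
Proof.
move=> infG d; have [i0 hi0] : exists i0, ~ (qdiam S (N i0) <= d)%N.
  by apply/existsNP => hd; apply: infG; apply: bounded_qdiam_finite hd.
by exists i0 => i /qdiam_leq; move/negP: hi0; lia.
Qed.

End BoxMetric.

(** The map [f'] picks a point whose image is [C]-close, and short words realise all the required
    paths. The constant [2 * C + 1] bounds the distance between [f (f' v)] and [f (f' v')] for
    neighbours [v], [v']. *)
Lemma scale_equivalence_of (G H : groupType) (S : set G) (T : set H)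
    (K : normal_subgroup G) (L : normal_subgroup H)
    (f : quotient_group K -> quotient_group L) (C c : nat) :
  spanning S -> spanning T -> (C <= c)%N ->
  (forall a b, qlen S (a^-1 * b)%g <= 1 -> qlen T ((f a)^-1 * f b)%g <= c)%N ->
  (forall y, exists x, qlen T (y^-1 * f x)%g <= C)%N ->
  (forall a b, qlen T ((f a)^-1 * f b)%g <= 2 * C + 1 -> qlen S (a^-1 * b)%g <= c)%N ->
  scale_equivalence S T K L c.
Proof.
move=> hS hT Cc lip dense expd; have /choice[f' f'P] := dense.
have triangle (x y z : quotient_group L) :
    (qlen T (x^-1 * z)%g <= qlen T (x^-1 * y)%g + qlen T (y^-1 * z)%g)%N.
  have -> : x^-1 * z = (x^-1 * y) * (y^-1 * z) by rewrite mulgA mulgK.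
  exact: (lenM (spanning_image hT)).
have sym (x y : quotient_group L) : qlen T (x^-1 * y)%g = qlen T (y^-1 * x)%g.
  by rewrite /qlen -(lenV (spanning_image hT)) invgM invgK.
have qlenl s : letter S s -> (qlen S (coset_proj K s) <= 1)%N.
  exact: qlen_letter.
have qlenl' t : letter T t -> (qlen T (coset_proj L t) <= 1)%N.
  exact: qlen_letter.
have /choice[e he] : forall vs : quotient_group K * G, exists w, letter S vs.2 ->
    [/\ letters T w, (size w <= c)%N &
        f vs.1 * coset_proj _ (wprod w) = f (vs.1 * coset_proj _ vs.2)].
  move=> [v s] /=; have [hs | ns] := EM (letter S s); last by exists [::].
  have [|w [hw sw we]] := qlen_word hT (n := c) (q := (f v)^-1 * f (v * coset_proj _ s)).
    by apply: lip; rewrite mulKg; apply: qlenl.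
  by exists w => _; rewrite we mulVKg.
have /choice[e' he'] : forall vs : quotient_group L * H, exists w, letter T vs.2 ->
    [/\ letters S w, (size w <= c)%N &
        f' vs.1 * coset_proj _ (wprod w) = f' (vs.1 * coset_proj _ vs.2)].
  move=> [v t] /=; have [ht | nt] := EM (letter T t); last by exists [::].
  set v' := v * _.
  have [|w [hw sw we]] := qlen_word hS (n := c) (q := (f' v)^-1 * f' v').
    apply: expd; have := f'P v; have := f'P v'.
    have := triangle (f (f' v)) v (f (f' v')); have := triangle v v' (f (f' v')).
    have : (qlen T (v^-1 * v')%g <= 1)%N by rewrite mulKg; apply: qlenl'.
    by rewrite (sym (f (f' v)) v); lia.
  by exists w => _; rewrite we mulVKg.
have /choice[k hk] : forall y, exists w, [/\ letters T w, (size w <= c)%N &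
    y * coset_proj L (wprod w) = f (f' y)].
  move=> y; have [|w [hw sw we]] := qlen_word hT (n := c) (q := y^-1 * f (f' y)).
    by have := f'P y; lia.
  by exists w; rewrite we mulVKg.
have /choice[k' hk'] : forall x, exists w, [/\ letters S w, (size w <= c)%N &
    x * coset_proj K (wprod w) = f' (f x)].
  move=> x; have [|w [hw sw we]] := qlen_word hS (n := c) (q := x^-1 * f' (f x)).
    by apply: expd; have := f'P (f x); lia.
  by exists w; rewrite we mulVKg.
exists f, f', (fun v s => e (v, s)), (fun v t => e' (v, t)), k, k'; split=> //.
- by move=> v s; apply: (he (v, s)).
- by move=> v t; apply: (he' (v, t)).
Qed.

(** * Matching components of coarsely equivalent box spaces *)

Section Components.
Variables (G H : groupType) (S : set G) (T : set H).
Variables (N : nat -> normal_subgroup G) (M : nat -> normal_subgroup H).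
Hypotheses (hS : spanning S) (hT : spanning T).
Hypotheses (fS : finite_set S) (fT : finite_set T).
Hypotheses (hN : is_filtration N) (hM : is_filtration M).
Variable f : box_space N -> box_space M.
Hypothesis hf : nat_coarse_equivalence (box_ndist S (N := N)) (box_ndist T (N := M)) f.

(** A finite group has bounded box spaces, boundedness passes through a coarse equivalence in both
    directions, and bounded component diameters force the group to be finite. *)
Lemma finite_box_transfer : finite_set [set: G] <-> finite_set [set: H].
Proof.
have [fN nN cN] := hN; have [fM nM cM] := hM; have [up lo [C cP]] := hf.
split=> [/(finite_box_bounded (N := N) hS fN)[d dP] | /(finite_box_bounded (N := M) hT fM)[d dP]].
  have [m mP] := up d.
  apply: (@bounded_qdiam_finite _ T M hT fM nM cM fT (C + m + C)) => j.
  have [q <-] := qdiam_attained hT fM j.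
  have := box_ndist_same T (N := M) 1 q; rewrite invg1 mul1g => <-.
  have [x hx] := cP (box_point (1 : quotient_group (M j))).
  have [y hy] := cP (box_point q).
  have hxy := mP x y (dP x y).
  have := box_ndist_triangle hT fM (box_point (1 : quotient_group (M j))) (f x) (box_point q).
  have := box_ndist_triangle hT fM (f x) (f y) (box_point q).
  by rewrite (box_ndist_sym hT (f y)); lia.
have [m mP] := lo d.
apply: (@bounded_qdiam_finite _ S N hS fN nN cN fS m) => i.
have [q <-] := qdiam_attained hS fN i.
have := box_ndist_same S (N := N) 1 q; rewrite invg1 mul1g => <-.
exact: mP.
Qed.

(** Distinct components are separated by their diameters, which tend to infinity. So far out,
    neither a unit step in the source nor a bounded correction can change component, and [f]
    restricts to a map between single components. *)
Lemma components_scale_equivalence : ~ finite_set [set: G] -> exists c, forall n,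
  exists i j, [/\ (n <= i)%N, (n <= j)%N & scale_equivalence S T (N i) (M j) c].
Proof.
move=> infG; have infH : ~ finite_set [set: H] by move/finite_box_transfer.
have [fN nN cN] := hN; have [fM nM cM] := hM; have [up lo [C cP]] := hf.
have [c1 c1P] := up 1%N; have [D DP] := lo (2 * C + 1)%N.
exists (C + c1 + D)%N => n.
(* Past [j1], target components are too large to be left by a jump of length [c1] or [C]. *)
have [j1 j1P] := unbounded_qdiam hT fM nM cM fT infH (c1 + 2 * C + 1).
pose j0 := (n + j1)%N.
have [E EP] := lo (2 * qdiam T (M j0))%N.
(* Past [i1], source points at distance at most [D] or [E] share a component: [E] serves to keep
   images away from the first target components, [D] to prove density. *)
have [i1 i1P] := unbounded_qdiam hS fN nN cN fS infG (D + E).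
(* A bounded part of the target is hit by finitely many components only. *)
have [i2 i2P] : exists i2, forall i (a : quotient_group (N i)), (i1 + i2 <= i)%N ->
    (j0 < tag (f (box_point a)))%N.
  have [[x0 x0P] | nx] := EM (exists x0, (tag (f x0) <= j0)%N); last first.
    by exists 0%N => i a _; rewrite ltnNge; apply/negP => h; apply: nx; exists (box_point a).
  case: x0 x0P => [k b] x0P; exists k.+1 => i a hi; rewrite ltnNge; apply/negP => h.
  have := EP (box_point a) (box_point b) (box_ndist_qdiam hT fM nM h x0P).
  rewrite box_ndist_diff; last by lia.
  by have := i1P i; lia.
pose i := (n + i1 + i2)%N.
have i1i : (D + E < qdiam S (N i))%N by apply: i1P; rewrite /i; lia.
have step (a b : quotient_group (N i)) : (qlen S (a^-1 * b)%g <= 1)%N ->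
    tag (f (box_point a)) = tag (f (box_point b)).
  rewrite -box_ndist_same => /c1P.
  have : (j0 < tag (f (box_point a)))%N by apply: i2P; rewrite /i; lia.
  case: (f (box_point a)) (f (box_point b)) => [j a'] [k b'] /= hj.
  rewrite -/(box_point a') -/(box_point b') => hd; apply/not_notP => jk; move: hd.
  by rewrite box_ndist_diff //; have := j1P j; rewrite /j0 in hj; lia.
have same_tag (a : quotient_group (N i)) :
    tag (f (box_point a)) = tag (f (box_point (1 : quotient_group (N i)))).
  have [m [w [hw _ we]]] := hS (repr a).
  have -> : a = 1 * coset_proj (N i) (wprod w) by rewrite we coset_reprK mul1g.
  elim: w hw {we} (1 : quotient_group (N i)) => [_ v|s w IH /letters_cons[hs hw] v].
    by rewrite wprod_nil mulg1.
  rewrite wprod_cons cosetM mulgA IH //; apply: esym; apply: step.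
  by rewrite mulKg; apply: qlen_letter.
pose j := tag (f (box_point (1 : quotient_group (N i)))).
have jj0 : (j0 < j)%N by apply: i2P; rewrite /i; lia.
have /choice[phi phiP] : forall a : quotient_group (N i), exists b : quotient_group (M j),
    f (box_point a) = box_point b.
  move=> a; have := same_tag a; rewrite -/j; case: (f (box_point a)) => [k b] /= kj.
  by subst k; exists b.
exists i, j; split; [rewrite /i; lia | rewrite /j0 in jj0; lia |].
have lip a b : (qlen S (a^-1 * b)%g <= 1)%N -> (qlen T ((phi a)^-1 * phi b)%g <= c1)%N.
  by rewrite -!box_ndist_same -!phiP; apply: c1P.
have expd a b : (qlen T ((phi a)^-1 * phi b)%g <= 2 * C + 1)%N -> (qlen S (a^-1 * b)%g <= D)%N.
  by rewrite -!box_ndist_same -!phiP; apply: DP.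
apply: (@scale_equivalence_of _ _ _ _ _ _ phi C) => //; first lia.
- by move=> a b /lip; lia.
(* Density within the component [j]: walk from [phi 1] to [y] one letter at a time, staying
   [C]-close to the image of [phi]. The next point is [C]-close to some [f x'], so [f x'] is within
   [2 * C + 1] of the previous image; hence [x'] is within [D] of [x] and lies in component [i]. *)
- move=> y; have [m [w [hw _ we]]] := hT (repr ((phi 1)^-1 * y)).
  have -> : y = phi 1 * coset_proj (M j) (wprod w) by rewrite we coset_reprK mulVKg.
  have : exists x, (qlen T ((phi 1)^-1 * phi x)%g <= C)%N.
    by exists 1; rewrite mulVg /qlen (len1 (spanning_image hT)).
  elim: w hw {y we} (phi 1) => [_ v|t w IH /letters_cons[ht hw] v hv].
    by rewrite wprod_nil mulg1.
  rewrite wprod_cons cosetM mulgA; apply: IH => // {w hw}.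
  have [x xP] := hv; set v' : quotient_group (M j) := v * _.
  have [x' x'P] := cP (box_point v').
  have [b fb] : exists b : quotient_group (M j), f x' = box_point b.
    by apply: (@box_ndist_lt_qdiam _ T _ j v'); have := j1P j; rewrite /j0 in jj0; lia.
  rewrite fb box_ndist_same in x'P.
  have vv' : (qlen T (v^-1 * v')%g <= 1)%N by rewrite mulKg; apply: qlen_letter.
  have hd : (box_ndist T (f (box_point x)) (f x') <= 2 * C + 1)%N.
    have := box_ndist_triangle hT fM (f (box_point x)) (box_point v) (f x').
    have := box_ndist_triangle hT fM (box_point v) (box_point v') (f x').
    by rewrite (box_ndist_sym hT (f (box_point x)) (box_point v)) fb phiP !box_ndist_same; lia.
  have [x'' x''E] : exists a : quotient_group (N i), x' = box_point a.
    by apply: (@box_ndist_lt_qdiam _ S _ i x); have := DP _ _ hd; lia.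
  exists x''; rewrite (_ : phi x'' = b) //.
  have := phiP x''; rewrite -x''E fb => /eqP.
  by rewrite eq_Tagged => /eqP.
- by move=> a b /expd; lia.
Qed.

End Components.

Lemma finite_commensurable (G H : groupType) :
  finite_set [set: G] -> finite_set [set: H] -> commensurable_via_normal G H.
Proof.
have trivial_normal (K : groupType) : is_normal [set 1 : K].
  split=> [|x y ->]; last exact: conj1g.
  by apply/is_subgroupP; split=> // x y -> ->; rewrite mulgV.
have trivial_index (K : groupType) : finite_set [set: K] ->
    finite_index (NormalSubgroup (trivial_normal K)).
  move=> finK; apply: sub_finite_set (finite_image (@coset_proj K _) finK).
  by move=> q _; exists (repr q); rewrite ?coset_reprK.
move=> finG finH.
exists (NormalSubgroup (trivial_normal G)), (NormalSubgroup (trivial_normal H)).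
split; [exact: trivial_index | exact: trivial_index |].
exists (fun=> 1); split; last by move=> x y _ _; rewrite mulg1.
split=> [x //| x y |x ->]; first by rewrite !inE => -> ->.
by exists 1.
Qed.

Theorem commensurable_of_coarse_equivalence (G H : groupType) (S : set G) (T : set H)
    (N : nat -> normal_subgroup G) (M : nat -> normal_subgroup H)
    (f : box_space N -> box_space M) :
  finitely_presented G -> finite_set S -> generates S -> finite_set T -> generates T ->
  is_filtration N -> is_filtration M ->
  nat_coarse_equivalence (box_ndist S (N := N)) (box_ndist T (N := M)) f ->
  commensurable_via_normal G H.
Proof.
move=> fpG fS gS fT gT hN hM hf.
have hS : spanning S := generates_ball gS; have hT : spanning T := generates_ball gT.
(* For finite groups the diameters stay bounded and components need not be matched, but the trivial
   subgroups are already commensurable. *)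
have [finG | infG] := EM (finite_set [set: G]).
  by apply: finite_commensurable => //; apply/(finite_box_transfer hS hT fS fT hN hM hf).
have [c cP] := components_scale_equivalence hS hT fS fT hN hM hf infG.
have large r : exists i j, [/\ injectivity_radius S (N i) r, injectivity_radius T (M j) r &
    scale_equivalence S T (N i) (M j) c].
  have [fN nN cN] := hN; have [fM nM cM] := hM.
  have [i0 i0P] := filtration_injectivity_radius nN cN fS r.
  have [j0 j0P] := filtration_injectivity_radius nM cM fT r.
  have [i [j [hi hj sc]]] := cP (i0 + j0)%N.
  by exists i, j; split=> //; [apply: i0P | apply: j0P]; lia.
have [r rP] := finitely_presented_ceq_complete fS gS fpG.
have [r' r'P] : exists r', ceq_complete T r'.
  apply: (ceq_complete_transfer (c := c) rP) => n; have [i [j ?]] := large n.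
  by exists (N i), (M j).
(* The scale [r + r'] is one at which both groups are complete. *)
have [i [j [hi hj sc]]] := large (c * (r + r') + (c * c + 2 * c + 2))%N.
have [fN nN cN] := hN; have [fM nM cM] := hM.
exists (N i), (M j); split=> //.
apply: (isomorphic_of_scale_equivalence (r := (r + r')%N) gS gT _ _ hi hj sc).
- by move=> u v hu hv /rP h; apply: ceq_leq (h hu hv); rewrite leq_addr.
- by move=> u v hu hv /r'P h; apply: ceq_leq (h hu hv); rewrite leq_addl.
Qed.

(** * From commensurability to box spaces *)

Definition mult_on (G : groupType) (K : set G) (X : Type) (op : X -> X -> X)
    (h : G -> X) : Prop :=
  forall x y, K x -> K y -> h (x * y) = op (h x) (h y).

(* Characteristic in K, and of finite index when K is finitely generated: magmas on a
   fixed finite set stand in for the finite quotients of K. *)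
Definition magma_kernel (G : groupType) (K : set G) (n : nat) : set G :=
  [set k | K k /\ forall op (h : G -> 'I_n.+1), mult_on K op h -> h k = h 1].

Section MagmaKernel.
Variables (G : groupType) (K : normal_subgroup G).

Let sK : is_subgroup K := (normal_setP K).1.

(** Precomposing a magma map on [K] with conjugation by [g] gives another one, whence normality in
    all of [G]. Closure under division is computed without associativity or a unit in the magma. *)
Lemma magma_kernel_normal n : is_normal (magma_kernel K n).
Proof.
split; first (apply/is_subgroupP; split).
- by split=> //; exact: subgroup1.
- move=> x y [Kx hx] [Ky hy].
  have Kyi := subgroupV sK Ky; have K1 := subgroup1 sK.
  split=> [|op h hh]; first exact: subgroupM.
  rewrite hh // (hx op h hh) -(hh _ _ K1 Kyi) mul1g.
  by rewrite -(mulgV y) hh // (hy op h hh) -(hh _ _ K1 Kyi) mul1g.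
- move=> x g [Kx hx]; split=> [|op h hh]; first exact: (normal_setP K).2.
  have := hx op (fun y => h (y ^ g)); rewrite conj1g; apply=> y z Ky Kz.
  by rewrite conjMg hh //; apply: (normal_setP K).2.
Qed.

(** A magma on [n + 1] elements is padded to one on [n + 2] elements, so the larger size tests at
    least as many maps. *)
Lemma magma_kernel_nested n : magma_kernel K n.+1 `<=` magma_kernel K n.
Proof.
move=> k [Kk hk]; split=> // op h hh.
have wK : cancel (widen_ord (leqnSn n.+1)) (fun a : 'I_n.+2 => inord a : 'I_n.+1).
  by move=> a; apply: val_inj; rewrite /= inordK.
apply: (can_inj wK).
apply: (hk (fun a b => widen_ord (leqnSn n.+1) (op (inord a) (inord b)))
           (fun x => widen_ord (leqnSn n.+1) (h x))) => x y Kx Ky.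
by rewrite hh // [inord _]wK [inord _]wK.
Qed.

Lemma magma_kernel_separates (N : normal_subgroup G) g :
  finite_index N -> ~ normal_set N g -> exists n, ~ magma_kernel K n g.
Proof.
(* The multiplication of [G/N] is transported to indices in the list [s]; the surplus index [size s]
   decodes to the default 1. *)
move=> /finite_seqP[s sE] Ng; exists (size s) => -[_ hg]; apply: Ng.
have ins (q : quotient_group N) : q \in s by have : [set` s] q by rewrite -sE.
pose code (q : quotient_group N) : 'I_(size s).+1 := inord (index q s).
have codeK : cancel code (fun a => nth 1 s a).
  by move=> q; rewrite inordK ?nth_index // ltnS index_size.
apply/coset_proj1P; apply: (can_inj codeK).
apply: (hg (fun a b => code (nth 1 s a * nth 1 s b)) (fun x => code (coset_proj N x))).
by move=> x y _ _; rewrite !codeK cosetM.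
Qed.

End MagmaKernel.

Lemma magma_kernel_map (G H : groupType) (K : set G) (L : set H) (phi : G -> H) n k :
  (forall x, K x -> L (phi x)) -> mult_on K *%g phi -> K 1 ->
  magma_kernel K n k -> magma_kernel L n (phi k).
Proof.
move=> KL hphi K1 [Kk hk]; split=> [|op h hh]; first exact: KL.
have phi1 : phi 1 = 1 by apply: (mulgI (phi 1)); rewrite -hphi // !mulg1.
rewrite -[in RHS]phi1; apply: (hk op (h \o phi)) => x y Kx Ky /=.
by rewrite hphi // hh //; apply: KL.
Qed.

Lemma finite_index_of_code (G : groupType) (N : normal_subgroup G) (Z : Type) (F : G -> Z) :
  finite_set (range F) -> (forall x y, F x = F y -> normal_set N (x^-1 * y)) ->
  finite_index N.
Proof.
move=> finF FN.
have /choice[p hp] : forall z, exists q, forall x, F x = z -> coset_proj N x = q.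
  move=> z; have [[x xz]|nz] := EM (exists x, F x = z); last first.
    by exists 1 => x xz; case: nz; exists x.
  by exists (coset_proj N x) => y yz; apply/coset_projE/FN; rewrite yz.
apply: (sub_finite_set _ (finite_image p finF)) => q _.
exists (F (repr q)); first by exists (repr q).
by rewrite -(hp _ _ erefl) coset_reprK.
Qed.

(* Schreier's lemma, for the transversal [repr]. *)
Lemma finite_index_generators (G : groupType) (S : set G) (K : normal_subgroup G) :
  finite_set S -> generates S -> finite_index K ->
  exists B : set G, [/\ finite_set B, B `<=` K &
    forall k, normal_set K k -> exists2 w, letters B w & wprod w = k].
Proof.
move=> fS gS fK.
pose B : set G := [set x | normal_set K x] `&`
  [set x / y | x in [set repr q * s | q in [set: quotient_group K] & s in letter S]
             & y in [set (repr q : G) | q in [set: quotient_group K]]].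
have schreier w (q : quotient_group K) : letters S w ->
    exists2 v, letters B v & repr q * wprod w = wprod v * repr (q * coset_proj K (wprod w)).
  elim: w q => [|s w IH] q.
    by exists [::] => //; rewrite !wprod_nil mulg1 mul1g coset1 mulg1.
  move=> /letters_cons[hs /(IH (q * coset_proj K s))[v hv ve]].
  pose r : G := repr (q * coset_proj K s).
  exists (repr q * s / r :: v).
    apply/letters_cons; split=> //; left; split.
      by apply/coset_proj1P; rewrite !cosetM cosetV !coset_reprK mulgV.
    exists (repr q * s); first by exists q => //; exists s.
    by exists r => //; exists (q * coset_proj K s).
  rewrite !wprod_cons cosetM (mulgA q) -[RHS]mulgA -ve.
  by rewrite -/r !mulgA mulgVK.
exists B; split.
- apply: finite_setIr; apply: finite_image2; last exact: finite_image.
  by apply: finite_image2 => //; apply: finite_letter.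
- by move=> x [].
- move=> k Kk; pose r : G := repr (1 : quotient_group K).
  have [w hw we] := generates_word gS (r^-1 * k * r).
  have [v hv] := schreier w 1 hw; rewrite we -/r => ve.
  have piw : coset_proj K (r^-1 * k * r) = 1.
    by have /coset_proj1P pik := Kk; rewrite !cosetM cosetV pik mulg1 mulVg.
  exists v => //; apply: (mulIg r); rewrite piw mulg1 -/r in ve.
  by rewrite -ve !mulgA mulgV mul1g.
Qed.

(** As [K] is finitely generated, a magma map on it is determined by finitely many data, so finitely
    many maps suffice to cut out the kernel. *)
Lemma magma_kernel_finite_index (G : groupType) (S : set G) (K : normal_subgroup G) n :
  finite_set S -> generates S -> finite_index K ->
  finite_index (NormalSubgroup (magma_kernel_normal K n)).
Proof.
move=> fS gS fK; have [B [finB BK genB]] := finite_index_generators fS gS fK.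
have sK : is_subgroup K := (normal_setP K).1.
have [b bE] := (finite_seqP _).1 (finite_letter finB).
have inb x : letter B x -> x \in b by move=> hx; have : [set` b] x by rewrite -bE.
have lK x : letter B x -> normal_set K x.
  by case=> [/BK // | /BK /(subgroupV sK)]; rewrite invgK.
pose I := 'I_n.+1.
(* A multiplication table, the values on the generators of [K] and their inverses, and the value at
   1, which starts the induction on words. *)
pose data : finType := ({ffun I * I -> I} * (size b).-tuple I * I)%type.
pose fits (d : data) (h : G -> I) := [/\ mult_on K (fun x y => d.1.1 (x, y)) h,
  map h b = d.1.2 & h 1 = d.2].
(* One chosen map for each realisable datum; by [unique] it agrees on [K] with every map having that
   datum. *)
have /choice[hd hdP] : forall d, exists h, (exists h', fits d h') -> fits d h.
  move=> d; have [[h hh]|nh] := EM (exists h, fits d h); first by exists h.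
  by exists (fun=> ord0) => /nh.
have unique d h h' k : fits d h -> fits d h' -> normal_set K k -> h k = h' k.
  move=> [hm hb h1] [hm' hb' h1'] /genB[w hw <-].
  have eqb x : letter B x -> h x = h' x.
    move=> /inb xb; have /eq_in_map : map h b = map h' b by rewrite hb hb'.
    exact.
  suff [] : h (wprod w) = h' (wprod w) /\ normal_set K (wprod w) by [].
  elim: w hw => [_|x w IH /letters_cons[hx /IH[hw Kw]]].
    by rewrite wprod_nil h1 h1'; split=> //; apply: subgroup1.
  rewrite wprod_cons hm ?hm' ?hw ?eqb //; try exact: lK.
  by split=> //; apply: subgroupM => //; apply: lK.
pose sig k : {ffun data -> I} := [ffun d => hd d k].
have sigP k k' : normal_set K k -> normal_set K k' -> sig k = sig k' ->
    magma_kernel K n (k^-1 * k').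
  move=> Kk Kk' kk'; have Kki := subgroupV sK Kk; split=> [|op h hh].
    exact: subgroupM.
  pose d : data := ([ffun p => op p.1 p.2], [tuple of map h (in_tuple b)], h 1).
  have hd_fits : fits d (hd d).
    by apply: hdP; exists h; split=> // x y Kx Ky; rewrite ffunE hh.
  have h_fits : fits d h by split=> // x y Kx Ky; rewrite ffunE hh.
  have hkk' : h k = h k'.
    rewrite (unique d h (hd d)) // (unique d h (hd d) k') //.
    by have /ffunP/(_ d) := kk'; rewrite !ffunE.
  by rewrite hh // -hkk' -hh // mulVg.
pose r x : G := repr (coset_proj K x).
(* An element of [G] is coded by its coset of [K] and the signature of its [K]-part. With equal
   codes, the [K]-parts differ by the kernel, and conjugation by the common representative preserves
   it. *)
apply: (@finite_index_of_code _ _ _ (fun x => (coset_proj K x, sig (x / r x)))).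
  apply: (@sub_finite_set _ _ ([set: quotient_group K] `*` [set: {ffun data -> I}])).
    by move=> _ [x _ <-].
  by apply: finite_setX => //; apply: finite_finset.
move=> x y [xy]; have rxy : r x = r y by rewrite /r xy.
have Kr z : normal_set K (z / r z).
  by apply/coset_proj1P; rewrite cosetM cosetV coset_reprK mulgV.
move=> /(sigP _ _ (Kr x) (Kr y)); rewrite rxy => ker.
have -> : x^-1 * y = ((x / r y)^-1 * (y / r y)) ^ r y by gnorm.
exact: (magma_kernel_normal K n).2.
Qed.

(** * Coarse equivalences assembled component by component *)

Section FibrewiseMaps.
Variables (G H : groupType) (S : set G) (T : set H).
Variables (N : nat -> normal_subgroup G) (M : nat -> normal_subgroup H).
Hypotheses (hS : spanning S) (hT : spanning T).
Hypotheses (fN : forall i, finite_index (N i)) (fM : forall i, finite_index (M i)).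
Variable f : forall i, quotient_group (N i) -> quotient_group (M i).

(** Uniform bounds within components also make the diameters of corresponding components control
    each other, and distances between components are sums of diameters. *)
Lemma fibrewise_coarse_equivalence :
  (forall n, exists m, forall i (a b : quotient_group (N i)),
     qlen S (a^-1 * b)%g <= n -> qlen T ((f a)^-1 * f b)%g <= m)%N ->
  (forall n, exists m, forall i (a b : quotient_group (N i)),
     qlen T ((f a)^-1 * f b)%g <= n -> qlen S (a^-1 * b)%g <= m)%N ->
  (exists C, forall i (y : quotient_group (M i)), exists a,
     qlen T (y^-1 * f a)%g <= C)%N ->
  nat_coarse_equivalence (box_ndist S (N := N)) (box_ndist T (N := M))
    (fun p => box_point (f (tagged p))).
Proof.
move=> up lo [C dense].
have [upd lod] : (forall n, exists m, forall i, (qdiam S (N i) <= n -> qdiam T (M i) <= m)%N) /\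
    (forall n, exists m, forall i, (qdiam T (M i) <= n -> qdiam S (N i) <= m)%N).
  split=> n.
    have [m mP] := up n; exists (C + m + C)%N => i dn.
    have [q <-] := qdiam_attained hT fM i.
    have [a ha] := dense i 1; have [b hb] := dense i q.
    have hab := mP i a b (leq_trans (qdiam_ge hS fN _) dn).
    have := box_ndist_triangle hT fM (box_point (1 : quotient_group (M i)))
      (box_point (f a)) (box_point q).
    have := box_ndist_triangle hT fM (box_point (f a)) (box_point (f b)) (box_point q).
    rewrite (box_ndist_sym hT (box_point (f b))) !box_ndist_same.
    by rewrite invg1 !mul1g in ha *; lia.
  have [m mP] := lo n; exists m => i dn.
  have [q <-] := qdiam_attained hS fN i.
  have := mP i 1 q; rewrite invg1 mul1g; apply.
  exact: leq_trans (qdiam_ge hT fM _) dn.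
split.
- move=> n; have [m mP] := up n; have [d dP] := upd n.
  exists (m + (d + d))%N => -[i a] [j b] /=; rewrite -/(box_point a) -/(box_point b).
  have [ij | ij] := EM (i = j).
    by subst j; rewrite !box_ndist_same => /mP; lia.
  by rewrite !box_ndist_diff // => hn; have := dP i; have := dP j; lia.
- move=> n; have [m mP] := lo n; have [d dP] := lod n.
  exists (m + (d + d))%N => -[i a] [j b] /=; rewrite -/(box_point a) -/(box_point b).
  have [ij | ij] := EM (i = j).
    by subst j; rewrite !box_ndist_same => /mP; lia.
  by rewrite !box_ndist_diff // => hn; have := dP i; have := dP j; lia.
- exists C => -[i y]; have [a ha] := dense i y; exists (box_point a).
  by rewrite -/(box_point y) box_ndist_same.
Qed.

End FibrewiseMaps.

(** Balls are finite, so an arbitrary function [phi] is bounded on each; this stands in for a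
    Lipschitz estimate, as [phi] is multiplicative only on a subgroup. *)
Lemma ball_image_bound (G H : groupType) (S : set G) (T : set H) (phi : G -> H) n :
  finite_set S -> spanning T ->
  exists m, forall k, ball S n k -> ball T m (phi k).
Proof.
move=> fS hT; apply: (finite_set_bound (P := fun k m => ball T m (phi k))).
- exact: finite_ball.
- by move=> x i j ij; apply: ball_leq.
- by move=> x _; apply: hT.
Qed.

Lemma finite_index_bounded_reps (G : groupType) (S : set G) (K : normal_subgroup G) :
  spanning S -> finite_index K ->
  exists c, forall x, exists k, normal_set K k /\ ball S c (k^-1 * x).
Proof.
move=> hS fK; have [c cP] :=
  finite_set_nat_bound (fun q : quotient_group K => len S (repr q)) fK.
exists c => x; exists (x / repr (coset_proj K x)); split.
  by apply/coset_proj1P; rewrite cosetM cosetV coset_reprK mulgV.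
rewrite invgM invgK mulgVK; apply/len_ball => //; exact: (cP (coset_proj K x)).
Qed.

Section Commensurable.
Variables (G H : groupType) (S : set G) (T : set H).
Hypotheses (fS : finite_set S) (fT : finite_set T) (hS : spanning S) (hT : spanning T).
Variables (K : normal_subgroup G) (L : normal_subgroup H).
Hypotheses (fK : finite_index K) (fL : finite_index L).
Variables (phi : G -> H) (psi : H -> G).
Hypotheses (KL : forall k, normal_set K k -> normal_set L (phi k)).
Hypotheses (LK : forall l, normal_set L l -> normal_set K (psi l)).
Hypotheses (phiM : mult_on K *%g phi) (psiM : mult_on L *%g psi).
Hypotheses (phiK : forall k, normal_set K k -> psi (phi k) = k).
Hypotheses (psiK : forall l, normal_set L l -> phi (psi l) = l).
Variables (N : nat -> normal_subgroup G) (M : nat -> normal_subgroup H).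
Hypotheses (fN : forall i, finite_index (N i)) (fM : forall i, finite_index (M i)).
Hypotheses (NK : forall i, N i `<=` K) (ML : forall i, M i `<=` L).
Hypotheses (NM : forall i k, normal_set (N i) k -> normal_set (M i) (phi k)).
Hypotheses (MN : forall i l, normal_set (M i) l -> normal_set (N i) (psi l)).

Let sK : is_subgroup K := (normal_setP K).1.
Let sL : is_subgroup L := (normal_setP L).1.

Let phi1 : phi 1 = 1.
Proof. by apply: (mulgI (phi 1)); rewrite -phiM ?mulg1 //; exact: subgroup1. Qed.

Let phiV k : normal_set K k -> phi k^-1 = (phi k)^-1.
Proof.
move=> Kk; apply: (mulgI (phi k)); rewrite -phiM ?mulgV //.
exact: subgroupV.
Qed.

(** Each element is moved to [K] by a correction [r x] of length at most [c], and then sent through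
    the isomorphism of [K/N_i] with [L/M_i] induced by [phi]. *)
Lemma commensurable_nat_coarse_equivalence :
  exists f : box_space N -> box_space M,
    nat_coarse_equivalence (box_ndist S (N := N)) (box_ndist T (N := M)) f.
Proof.
have [c /choice[kap kapP]] := finite_index_bounded_reps hS fK.
have [c' lamP] := finite_index_bounded_reps hT fL.
have Kkap x : normal_set K (kap x) by case: (kapP x).
pose r x := (kap x)^-1 * x.
have br x : ball S c (r x) by case: (kapP x).
pose f i (q : quotient_group (N i)) : quotient_group (M i) :=
  coset_proj (M i) (phi (kap (repr q))).
have phi_mod i k t : normal_set K k -> coset_proj (N i) k = coset_proj (N i) t ->
    normal_set K t /\ coset_proj (M i) (phi k) = coset_proj (M i) (phi t).
  move=> Kk /coset_projE Nkt; have Kkt := NK Nkt.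
  have -> : t = k * (k^-1 * t) by rewrite mulVKg.
  split; first exact: subgroupM.
  rewrite phiM // cosetM; have /NM/coset_proj1P -> := Nkt.
  by rewrite mulg1.
have psi_mod i k t : normal_set L k -> coset_proj (M i) k = coset_proj (M i) t ->
    normal_set L t /\ coset_proj (N i) (psi k) = coset_proj (N i) (psi t).
  move=> Lk /coset_projE Mkt; have Lkt := ML Mkt.
  have -> : t = k * (k^-1 * t) by rewrite mulVKg.
  split; first exact: subgroupM.
  rewrite psiM // cosetM; have /MN/coset_proj1P -> := Mkt.
  by rewrite mulg1.
exists (fun p => box_point (f (tag p) (tagged p))).
apply: (@fibrewise_coarse_equivalence _ _ S T N M hS hT fN fM f).
(* If [g] of length at most [n] represents [a^-1 * b], the [K]-parts of [a] and [b] differ modulo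
   [N i] by [g] with a correction on either side. *)
- move=> n; have [m mP] := ball_image_bound phi (c + n + c) fS hT.
  exists m => i a b /(len_ball (spanning_image hS))/ball_image[g bg gab].
  have Kk : normal_set K ((kap (repr a))^-1 * kap (repr b)).
    by apply: subgroupM => //; apply: subgroupV.
  have [|_ ft] := phi_mod i _ (r (repr a) * g / r (repr b)) Kk.
    by rewrite /r !cosetM !cosetV !cosetM !cosetV gab !coset_reprK; gnorm.
  have -> : (f i a)^-1 * f i b = coset_proj (M i) (phi (r (repr a) * g / r (repr b))).
    rewrite /f -ft phiM ?phiV ?cosetM ?cosetV //.
    by apply: subgroupV.
  apply: leq_trans (qlen_coset _ hT _) _; apply/len_ball => //; apply: mP.
  by apply: ballM; [apply: ballM | apply: ballV].
- move=> n; have [m mP] := ball_image_bound psi n fT hS.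
  exists (c + m + c)%N => i a b /(len_ball (spanning_image hT))/ball_image[g bg gab].
  have Kk : normal_set K ((kap (repr a))^-1 * kap (repr b)).
    by apply: subgroupM => //; apply: subgroupV.
  have [|Lg gt] := psi_mod i (phi ((kap (repr a))^-1 * kap (repr b))) g (KL Kk).
    rewrite gab /f phiM ?phiV ?cosetM ?cosetV //.
    by apply: subgroupV.
  have -> : a^-1 * b = coset_proj (N i) ((r (repr a))^-1 * psi g * r (repr b)).
    rewrite !cosetM -gt phiK // /r !cosetV !cosetM !cosetV !coset_reprK; gnorm.
    by [].
  apply: leq_trans (qlen_coset _ hS _) _; apply/len_ball => //.
  by apply: ballM => //; apply: ballM; [apply: ballV | apply: mP].
(* The point [l] of [L] is [c']-close to [y]; the coset of [psi l] is sent back to [l] up to [phi]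
   of a correction of length at most [c]. *)
- have [m mP] := ball_image_bound phi c fS hT.
  exists (c' + m)%N => i y; have [l [Ll bl]] := lamP (repr y).
  exists (coset_proj (N i) (psi l)); pose x : G := repr (coset_proj (N i) (psi l)).
  have xl : coset_proj (N i) x = coset_proj (N i) (psi l) by rewrite coset_reprK.
  have Kk : normal_set K ((psi l)^-1 * kap x).
    by apply: subgroupM => //; apply: subgroupV => //; apply: LK.
  have [|_ ft] := phi_mod i _ (r x)^-1 Kk.
    by rewrite /r !(cosetM, cosetV) xl; gnorm.
  have -> : y^-1 * f i (coset_proj (N i) (psi l)) =
      coset_proj (M i) ((l^-1 * repr y)^-1 * phi (r x)^-1).
    rewrite cosetM -ft phiM ?phiV ?psiK //; try exact: LK; last by apply/(subgroupV sK)/LK.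
    by rewrite /f -/x !(cosetM, cosetV) coset_reprK; gnorm.
  apply: leq_trans (qlen_coset _ hT _) _; apply/len_ball => //.
  apply: ballM; first exact: ballV.
  by apply: mP; apply: ballV.
Qed.

End Commensurable.

Theorem coarse_equivalence_of_commensurable (G H : groupType) (S : set G) (T : set H) :
  residually_finite G -> finite_set S -> generates S -> finite_set T -> generates T ->
  commensurable_via_normal G H ->
  exists (N : nat -> normal_subgroup G) (M : nat -> normal_subgroup H),
    [/\ is_filtration N, is_filtration M & exists f : box_space N -> box_space M,
      nat_coarse_equivalence (box_ndist S (N := N)) (box_ndist T (N := M)) f].
Proof.
move=> rfG fS gS fT gT [K [L [fK fL [phi [[KL injphi surphi] phiM]]]]].
have sK : is_subgroup K := (normal_setP K).1.
have sL : is_subgroup L := (normal_setP L).1.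
have inj x y : normal_set K x -> normal_set K y -> phi x = phi y -> x = y.
  by move=> Kx Ky; apply: injphi; rewrite inE.
have /choice[psi psiP] : forall l, exists k, normal_set L l -> normal_set K k /\ phi k = l.
  move=> l; have [/surphi[k Kk kl] | nl] := EM (normal_set L l); first by exists k.
  by exists 1.
have LK l : normal_set L l -> normal_set K (psi l) by case/psiP.
have psiK l : normal_set L l -> phi (psi l) = l by case/psiP.
have phiK k : normal_set K k -> psi (phi k) = k.
  by move=> Kk; apply: inj => //; [apply/LK/KL | apply/psiK/KL].
have psiM : mult_on L *%g psi.
  move=> x y Lx Ly; apply: inj; first by apply/LK/(subgroupM sL).
    by apply: subgroupM => //; apply: LK.
  rewrite phiM ?psiK //; try exact: LK.
  exact: (subgroupM sL).
pose N i := NormalSubgroup (magma_kernel_normal K i).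
pose M i := NormalSubgroup (magma_kernel_normal L i).
have NM i k : normal_set (N i) k -> normal_set (M i) (phi k).
  by apply: magma_kernel_map => //; exact: subgroup1.
have MN i l : normal_set (M i) l -> normal_set (N i) (psi l).
  by apply: magma_kernel_map => //; exact: subgroup1.
(* Residual finiteness enters here: every finite quotient of [G] is seen by a large enough magma. *)
have capN k : (forall i, normal_set (N i) k) -> k = 1.
  move=> Nk; have [// | k1] := EM (k = 1).
  have [Q [fQ Qk]] := rfG k k1; have [n] := magma_kernel_separates K fQ Qk.
  by case; apply: Nk.
have fN i : finite_index (N i) by exact: magma_kernel_finite_index fS gS fK.
have fM i : finite_index (M i) by exact: magma_kernel_finite_index fT gT fL.
exists N, M; split.
- split=> //; first by move=> i; exact: magma_kernel_nested.
  apply/seteqP; split=> [k Nk | _ -> i _]; first by apply: capN => i; apply: Nk.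
  by apply: subgroup1; exact: (normal_setP (N i)).1.
- split=> //; first by move=> i; exact: magma_kernel_nested.
  apply/seteqP; split=> [l Ml | _ -> i _]; last first.
    by apply: subgroup1; exact: (normal_setP (M i)).1.
  (* Triviality of the intersection in [H] is carried over from [G] by [psi]. *)
  have [Ll _] := Ml 0%N I; have psil : psi l = 1.
    by apply: capN => i; apply/MN/Ml.
  rewrite /= -(psiK l Ll) psil; apply: (mulgI (phi 1)).
  by rewrite -phiM ?mulg1 //; exact: subgroup1.
- apply: (commensurable_nat_coarse_equivalence fS fT (generates_ball gS) (generates_ball gT)
    fK fL KL LK phiM psiM phiK psiK) => //.
  + by move=> i k [].
  + by move=> i l [].
Qed.

Theorem theorem1p6 (R : realType) (G H : groupType)
    (hGfp : finitely_presented G) (hGrf : residually_finite G)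
    (hHfg : finitely_generated H)
    (S : set G) (hSfin : finite_set S) (hSgen : generates S)
    (T : set H) (hTfin : finite_set T) (hTgen : generates T) :
  (exists (N : nat -> normal_subgroup G) (M : nat -> normal_subgroup H),
     [/\ is_filtration N, is_filtration M &
         coarsely_equivalent (@box_dist R G S N) (@box_dist R H T M)])
  <-> commensurable_via_normal G H.
Proof.
have hS : spanning S := generates_ball hSgen.
have hT : spanning T := generates_ball hTgen.
split=> [[N [M [hN hM [f]]]] | hGH].
  have [fN _ _] := hN; have [fM _ _] := hM.
  rewrite !box_distE // => /coarse_equivalence_nat.
  exact: commensurable_of_coarse_equivalence.
have [N [M [hN hM [f hf]]]] :=
  coarse_equivalence_of_commensurable hGrf hSfin hSgen hTfin hTgen hGH.
have [fN _ _] := hN; have [fM _ _] := hM.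
exists N, M; split=> //; exists f.
by rewrite !box_distE //; apply/coarse_equivalence_nat.
Qed.
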